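(* Let $\alpha,\beta,\lambda>0$. Let $\mathbb{X}$ and $\mathbb{Y}$ be free self-adjoint non-commutative random variables such that $\mathbb{X}$ has the free GIG distribution $\mu(-\lambda,\alpha,\beta)$ and $\mathbb{Y}$ has the free Poisson distribution with rate $\lambda$ and jump size $1/\alpha$. Then $\mathbb{X}+\mathbb{Y}$ has the free GIG distribution $\mu(\lambda,\alpha,\beta)$.
   Context: A $\star$-probability space is a pair $(\mathcal{A},\varphi)$, with $\mathcal{A}$ a unital $\star$-algebra and $\varphi:\mathcal{A}\to\mathbb{C}$ a linear functional with $\varphi(1_{\mathcal{A}})=1$ that is faithful, normal, tracial and positive; its elements are called random variables. The distribution of a self-adjoint $\mathbb{X}\in\mathcal{A}$ is the compactly supported probability measure $\mu$ on $\mathbb{R}$ with $\varphi(\mathbb{X}^n)=\int t^n\,d\mu(t)$ for all $n$. Freeness is in the sense of Voiculescu: $\mathbb{X},\mathbb{Y}$ are free if the unital algebras they generate are free with respect to $\varphi$. Free GIG distribution: for $\lambda\in\mathbb{R}$, $\alpha,\beta>0$, $\mu(\lambda,\alpha,\beta)$ is the probability measure supported on $[a,b]$ with density $$\frac{1}{2\pi}\sqrt{(x-a)(b-x)}\left(\frac{\alpha}{x}+\frac{\beta}{\sqrt{ab}\,x^2}\right),$$ where $0<a<b$ are the solution of $$1-\lambda+\alpha\sqrt{ab}-\beta\frac{a+b}{2ab}=0,\qquad 1+\lambda+\frac{\beta}{\sqrt{ab}}-\alpha\frac{a+b}{2}=0.$$ Free Poisson (Marchenko--Pastur) distribution with rate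 $\lambda\ge 0$ and jump size $\gamma>0$: the measure $\max\{0,1-\lambda\}\,\delta_0+\tilde\nu$, where $\tilde\nu$ is supported on $(\gamma(1-\sqrt\lambda)^2,\gamma(1+\sqrt\lambda)^2)$ with density $\frac{1}{2\pi\gamma x}\sqrt{4\lambda\gamma^2-(x-\gamma(1+\lambda))^2}$. Equivalently, its free cumulants are $\mathcal{R}_n=\lambda\gamma^n$, $n\ge 1$, i.e. its $r$-transform is $\frac{\lambda\gamma}{1-\gamma z}$. *)

(* Defs.v *)
From HB Require Import structures.
From mathcomp Require Import all_boot all_order all_algebra.
From mathcomp Require Import complex.
From mathcomp Require Import all_classical all_reals all_analysis.

Set Implicit Arguments.
Unset Strict Implicit.
Unset Printing Implicit Defensive.

Import Order.TTheory GRing.Theory Num.Theory.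
Import numFieldNormedType.Exports.

Local Open Scope classical_set_scope.
Local Open Scope ring_scope.
Local Open Scope complex_scope.

Section StarAlgebra.
Context {R : realType} {A : algType R[i]}.
Implicit Types (star : A -> A) (phi : A -> R[i]).

Definition is_star star : Prop :=
  [/\ involutive star,
      forall x y, star (x * y) = star y * star x
    & forall (c : R[i]) x y, star (c *: x + y) = c^* *: star x + star y].

(* The algebraic positive cone of a star-algebra; in a C*-algebra it consists
   of the elements star z * z. *)
Definition star_nonneg star (x : A) : Prop :=
  exists s : seq A, x = \sum_(z <- s) star z * z.

Definition star_le star (x y : A) : Prop := star_nonneg star (y - x).

Definition star_supremum star (D : set A) (x : A) : Prop :=
  (forall d, D d -> star_le star d x) /\
  (forall y, (forall d, D d -> star_le star d y) -> star_le star x y).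

(* Upward directed sets of self-adjoint elements play the role of increasing
   nets. On R[i] the order z <= w means Im z = Im w and Re z <= Re w. *)
Definition is_normal star phi : Prop :=
  forall (D : set A) (x : A),
    D !=set0 ->
    (forall d, D d -> star d = d) ->
    (forall d e, D d -> D e ->
       exists f, [/\ D f, star_le star d f & star_le star e f]) ->
    star_supremum star D x ->
    supremums (phi @` D) (phi x).

Definition is_positive star phi : Prop := forall x, 0 <= phi (star x * x).

Definition is_faithful star phi : Prop :=
  forall x, phi (star x * x) = 0 -> x = 0.

Definition is_tracial phi : Prop := forall x y, phi (x * y) = phi (y * x).

Definition generated_alg (G : set A) : set A :=
  smallest [set M : set A | GRing.subalg_closed (mem M)] G.

Definition free_family phi (I : Type) (B : I -> set A) : Prop :=
  forall (n : nat) (i : nat -> I) (a : nat -> A),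
    (forall k, (k <= n)%N -> B (i k) (a k)) ->
    (forall k, (k <= n)%N -> phi (a k) = 0) ->
    (forall k, (k < n)%N -> i k <> i k.+1) ->
    phi (\prod_(0 <= k < n.+1) a k) = 0.

End StarAlgebra.

Record starProbSpace (R : realType) := StarProbSpace {
  rvs :> algType R[i];
  star : rvs -> rvs;
  state : {scalar rvs};
  starP : is_star star;
  state1 : state 1 = 1;
  state_positive : is_positive star state;
  state_faithful : is_faithful star state;
  state_normal : is_normal star state;
  state_tracial : is_tracial state
}.

Arguments star {R s} x.
Arguments state {R s}.

Section RandomVariables.
Context {R : realType} {P : starProbSpace R}.
Implicit Types X Y : P.

Definition selfadjoint X : Prop := star X = X.

Definition free_rvs X Y : Prop :=
  free_family (state : P -> R[i])
    (fun b : bool => generated_alg [set if b then X else Y]).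

(* Compactness of the support makes every power integrable, so that the
   real-valued integral below is the n-th moment. *)
Definition distribution_of X (mu : probability (measurableTypeR R) R) : Prop :=
  (exists2 K : set R, compact K & mu (~` K) = 0%E) /\
  (forall n : nat, state (X ^+ n) = (\int[mu]_t t ^+ n)%:C).

End RandomVariables.

Section Laws.
Context {R : realType}.
Implicit Types mu : probability (measurableTypeR R) R.

Definition free_gig_ends (lambda alpha beta a b : R) : Prop :=
  [/\ 0 < a, a < b,
      1 - lambda + alpha * Num.sqrt (a * b)
        - beta * ((a + b) / (2 * (a * b))) = 0
    & 1 + lambda + beta / Num.sqrt (a * b) - alpha * ((a + b) / 2) = 0].

Definition free_gig_pdf (alpha beta a b x : R) : R :=
  (2 * pi)^-1 * Num.sqrt ((x - a) * (b - x)) *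
  (alpha / x + beta / (Num.sqrt (a * b) * x ^+ 2)).

Definition free_gig (lambda alpha beta : R) mu : Prop :=
  exists a b : R, free_gig_ends lambda alpha beta a b /\
    forall S : set R, measurable S ->
      mu S = (\int[lebesgue_measure]_(x in S `&` `[a, b])
                (free_gig_pdf alpha beta a b x)%:E)%E.

Definition free_poisson_pdf (lambda gamma x : R) : R :=
  (2 * pi * gamma * x)^-1 *
  Num.sqrt (4 * lambda * gamma ^+ 2 - (x - gamma * (1 + lambda)) ^+ 2).

Definition free_poisson_support (lambda gamma : R) : set R :=
  `]gamma * (1 - Num.sqrt lambda) ^+ 2, gamma * (1 + Num.sqrt lambda) ^+ 2[.

Definition free_poisson (lambda gamma : R) mu : Prop :=
  forall S : set R, measurable S ->
    mu S = ((Num.max 0 (1 - lambda))%R%:E * \d_(0%R : R) S +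
            \int[lebesgue_measure]_(x in S `&` free_poisson_support lambda gamma)
              (free_poisson_pdf lambda gamma x)%:E)%E.

End Laws.

(* Main.v *)
From HB Require Import structures.
From mathcomp Require Import all_boot all_order all_algebra.
From mathcomp Require Import complex ring.
From mathcomp Require Import all_classical all_reals all_analysis.
From mathcomp Require Import measurable_realfun.
Require Import Defs.

Set Implicit Arguments.
Unset Strict Implicit.
Unset Printing Implicit Defensive.

Import Order.TTheory GRing.Theory Num.Theory.
Import numFieldNormedType.Exports.
Local Open Scope ring_scope.

(** All laws involved have compact support, so the statement is about moments, and
    the moments are handled through formal power series.

    The Cauchy transform of the free GIG law with parameters [lambda], [alpha],
    [beta] satisfies a quadratic equation ([gig_equation]) whose coefficients are
    explicit except for one number [delta], which depends on the endpoints of the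
    support; the free Poisson law with rate [lambda] and jump [1 / alpha] satisfies
    the same equation with [beta = delta = 0]. Substituting
    [K = K' - lambda / (alpha - w)] in the equation of the functional inverse [K]
    of the Cauchy transform for [- lambda] yields the equation for [lambda], with
    [delta] replaced by [delta - lambda]; and [lambda / (alpha - w)] is the
    R-transform of the free Poisson law ([gig_subordination]). What remains is that
    R-transforms add under freeness, and that [delta - lambda] is the right number.

    Additivity ([free_sum_moments]) rests on an identity between resolvents: if the
    inverses of [P] and [Q] are [1 - EX] and [1 - EY] with [EX], [EY] centred in
    the algebras generated by [X] and [Y], then
    [P (1 - EX EY) Q = P + Q - 1], so the inverse of [P + Q - 1] is
    [(1 - EY) (1 - EX EY)^-1 (1 - EX)], which expands into [1] and alternating
    products of centred elements. All of this happens in the ring of power series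
    with coefficients in the algebra of random variables.

    The quadratic equation is derived from the density as follows. The integrals of
    [x ^+ n] against [sqrt ((x - a) (b - x))] obey a recursion, by integration by
    parts ([semicircle_int_recursion]), which is a differential equation for their
    generating series and identifies it with the expansion of
    [sqrt ((1 - a u) (1 - b u))] ([sqrt_series_sqr]); the integrals of [x^-1] and
    [x^-2] follow from the symmetry [x |-> a b / x] ([semicircle_intV]).

    Finally, [t |-> beta / (alpha t)] carries the endpoints for [- lambda] to
    endpoints for [lambda] ([free_gig_ends_reflect]). The free GIG law on the new
    segment is the law of the sum, because its [delta] is the one required. *)

(** * Formal power series *)

(** A type name of its own, so that multiplication below is the convolution
    product and not the pointwise product of functions. *)
Definition fps (A : nzRingType) : Type := nat -> A.

Section FpsRing.
Context {A : nzRingType}.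
Implicit Types (f g h : fps A) (n m k : nat).

HB.instance Definition _ := gen_eqMixin (fps A).
HB.instance Definition _ := gen_choiceMixin (fps A).

Definition fps_add f g : fps A := fun n => f n + g n.
Definition fps_opp f : fps A := fun n => - f n.
Definition fps_zero : fps A := fun=> 0.

Fact fps_addA : associative fps_add.
Proof. by move=> f g h; apply/funext => n; exact: addrA. Qed.

Fact fps_addC : commutative fps_add.
Proof. by move=> f g; apply/funext => n; exact: addrC. Qed.

Fact fps_add0 : left_id fps_zero fps_add.
Proof. by move=> f; apply/funext => n; exact: add0r. Qed.

Fact fps_addN : left_inverse fps_zero fps_opp fps_add.
Proof. by move=> f; apply/funext => n; exact: addNr. Qed.

HB.instance Definition _ :=
  GRing.isZmodule.Build (fps A) fps_addA fps_addC fps_add0 fps_addN.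

Definition fps_one : fps A := fun n => (n == 0)%:R.
Definition fps_mul f g : fps A := fun n => \sum_(j < n.+1) f j * g (n - j)%N.

Definition fps_trunc m f : {poly A} := \poly_(i < m) f i.

(** Coefficient [n] of a product only sees coefficients up to [n] of the
    factors, so the ring laws are inherited from truncations to polynomials. *)
Lemma fps_mul_coef m n f g (p q : {poly A}) : (n < m)%N ->
  (forall i, (i < m)%N -> p`_i = f i) -> (forall i, (i < m)%N -> q`_i = g i) ->
  fps_mul f g n = (p * q)`_n.
Proof.
move=> ltnm hp hq; rewrite coefM; apply: eq_bigr => j _.
by rewrite hp ?hq// (leq_ltn_trans _ ltnm)// ?leq_subr// -ltnS.
Qed.

Lemma fps_truncE m f i : (i < m)%N -> (fps_trunc m f)`_i = f i.
Proof. by move=> im; rewrite coef_poly im. Qed.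

Fact fps_mulA : associative fps_mul.
Proof.
move=> f g h; apply/funext => n.
set T := fps_trunc n.+1.
rewrite (@fps_mul_coef n.+1 n _ _ (T f) (T g * T h))//; last 2 first.
- by move=> i; exact: fps_truncE.
- move=> i lin; rewrite (@fps_mul_coef n.+1 i _ _ (T g) (T h))// => j;
    exact: fps_truncE.
rewrite (@fps_mul_coef n.+1 n _ _ (T f * T g) (T h)) ?mulrA//; last first.
  by move=> i; exact: fps_truncE.
move=> i lin; rewrite (@fps_mul_coef n.+1 i _ _ (T f) (T g))// => j;
  exact: fps_truncE.
Qed.

Fact fps_mul1l : left_id fps_one fps_mul.
Proof.
move=> f; apply/funext => n; rewrite /fps_mul big_ord_recl big1 => [|j _].
  by rewrite addr0 mul1r subn0.
by rewrite /fps_one mul0r.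
Qed.

Fact fps_mul1r : right_id fps_one fps_mul.
Proof.
move=> f; apply/funext => n; rewrite /fps_mul big_ord_recr big1 /= => [|j _].
  by rewrite add0r subnn mulr1.
by rewrite /fps_one subn_eq0 leqNgt ltn_ord mulr0.
Qed.

Fact fps_mulDl : left_distributive fps_mul +%R.
Proof.
move=> f g h; apply/funext => n; rewrite /fps_mul -[RHS]big_split/=.
by apply: eq_bigr => j _; exact: mulrDl.
Qed.

Fact fps_mulDr : right_distributive fps_mul +%R.
Proof.
move=> f g h; apply/funext => n; rewrite /fps_mul -[RHS]big_split/=.
by apply: eq_bigr => j _; exact: mulrDr.
Qed.

Fact fps_one_neq0 : fps_one != 0.
Proof.
apply/eqP => /(congr1 (fun f : fps A => f 0%N)).
by apply/eqP; exact: oner_neq0.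
Qed.

HB.instance Definition _ := GRing.Zmodule_isNzRing.Build (fps A)
  fps_mulA fps_mul1l fps_mul1r fps_mulDl fps_mulDr fps_one_neq0.

Lemma fpsD f g n : (f + g) n = f n + g n. Proof. by []. Qed.
Lemma fpsN f n : (- f) n = - f n. Proof. by []. Qed.
Lemma fpsB f g n : (f - g) n = f n - g n. Proof. by []. Qed.
Lemma fps0 n : (0 : fps A) n = 0. Proof. by []. Qed.
Lemma fps1 n : (1 : fps A) n = (n == 0)%:R. Proof. by []. Qed.
Lemma fpsM f g n : (f * g) n = \sum_(j < n.+1) f j * g (n - j)%N.
Proof. by []. Qed.
Lemma fpsM0 f g : (f * g) 0%N = f 0%N * g 0%N.
Proof. by rewrite fpsM big_ord1. Qed.
Lemma fps_sum I (r : seq I) (P : pred I) (F : I -> fps A) n :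
  (\sum_(i <- r | P i) F i) n = \sum_(i <- r | P i) F i n.
Proof. by elim/big_rec2: _ => // i x y _ <-. Qed.

Definition fpsC (a : A) : fps A := fun n => if n == 0 then a else 0.
Definition fpsX : fps A := fun n => (n == 1)%:R.

Lemma fpsCM a f n : (fpsC a * f) n = a * f n.
Proof.
rewrite fpsM big_ord_recl big1 => [|j _]; first by rewrite addr0 subn0.
by rewrite /fpsC mul0r.
Qed.

Lemma fpsMC f a n : (f * fpsC a) n = f n * a.
Proof.
rewrite fpsM big_ord_recr big1 /= => [|j _]; first by rewrite add0r subnn.
by rewrite /fpsC subn_eq0 leqNgt ltn_ord mulr0.
Qed.

Lemma fpsXM f n : (fpsX * f) n = if n is m.+1 then f m else 0.
Proof.
case: n => [|n]; first by rewrite fpsM0 mul0r.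
rewrite fpsM 2!big_ord_recl big1 => [|j _]; last by rewrite /fpsX mul0r.
by rewrite /fpsX/= mul0r mul1r add0r addr0 subn1.
Qed.

Lemma fpsMX f n : (f * fpsX) n = if n is m.+1 then f m else 0.
Proof.
case: n => [|n]; first by rewrite fpsM0 mulr0.
rewrite fpsM 2!big_ord_recr big1 => [|j _] /=; last first.
  rewrite /fpsX subSn 1?ltnW//; case: (n - j)%N (subn_gt0 j n); last by
    move=> ? _; rewrite mulr0.
  by rewrite ltn_ord.
by rewrite /fpsX subnn subSnn mulr0 mulr1 add0r addr0.
Qed.

Lemma fpsX_inj : injective (fun f => fpsX * f).
Proof.
by move=> f g /= fg; apply/funext => n; have := congr1 (@^~ n.+1) fg; rewrite !fpsXM.
Qed.

Fact fpsC_is_additive : {morph fpsC : a b / a - b}.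
Proof. by move=> a b; apply/funext => -[|n]; rewrite fpsB/fpsC/= ?subr0. Qed.

HB.instance Definition _ := GRing.isZmodMorphism.Build A (fps A) fpsC
  fpsC_is_additive.

Fact fpsC_is_multiplicative : monoid_morphism fpsC.
Proof.
split; first by apply/funext => -[|n].
by move=> a b; apply/funext => -[|n]; rewrite fpsCM /fpsC//= mulr0.
Qed.

HB.instance Definition _ := GRing.isMonoidMorphism.Build A (fps A) fpsC
  fpsC_is_multiplicative.

Definition fps_order_ge m f := forall n, (n < m)%N -> f n = 0.

Lemma fps_order_geM m k f g :
  fps_order_ge m f -> fps_order_ge k g -> fps_order_ge (m + k) (f * g).
Proof.
move=> fm gk n nmk; rewrite fpsM big1// => j _.
have [jm|mj] := ltnP j m; first by rewrite fm// mul0r.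
have jn : (j <= n)%N by rewrite -ltnS.
by rewrite gk ?mulr0// ltn_subLR// (leq_trans nmk)// leq_add2r.
Qed.

Lemma fps_order_geX (v : fps A) n : v 0%N = 0 -> fps_order_ge n (v ^+ n).
Proof.
move=> v0; elim: n => [//|n IH]; rewrite exprS -add1n.
by apply: fps_order_geM => // -[].
Qed.

(** If [f] starts in degree [k], coefficient [n] of [f * g] does not involve the
    last [k] of the coefficients of [g] up to [n]. *)
Lemma fpsM_order n k f g h : fps_order_ge k f ->
  (forall i, (i + k <= n)%N -> g i = h i) -> (f * g) n = (f * h) n.
Proof.
move=> fk gh; rewrite !fpsM; apply: eq_bigr => j _.
have [jk|kj] := ltnP j k; first by rewrite fk// !mul0r.
have jn : (j <= n)%N by rewrite -ltnS.
by rewrite gh// -leq_subRL ?leq_subr// subKn.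
Qed.

End FpsRing.
Arguments fpsX {A}.

Section FpsComRing.
Context {A : comNzRingType}.
Fact fps_mulC : commutative (@GRing.mul (fps A)).
Proof.
move=> f g; apply/funext => n; have TE := @fps_truncE A n.+1.
rewrite [LHS](@fps_mul_coef _ n.+1 _ _ _ (fps_trunc n.+1 f) (fps_trunc n.+1 g));
  [|by []|exact: TE..].
rewrite [RHS](@fps_mul_coef _ n.+1 _ _ _ (fps_trunc n.+1 g) (fps_trunc n.+1 f));
  [|by []|exact: TE..].
by rewrite mulrC.
Qed.
HB.instance Definition _ :=
  GRing.PzRing_hasCommutativeMul.Build (fps A) fps_mulC.
End FpsComRing.

Section FpsSeries.
Context {A : nzRingType}.
Implicit Types (F : nat -> fps A) (f g : fps A).

(** The sum of the [F k] when [F k] starts in degree at least [k]: then the terms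
    left out of the finite sum contribute nothing to coefficient [n]. *)
Definition fps_series F : fps A := fun n => \sum_(k < n.+1) F k n.

Definition fps_summable F := forall k, fps_order_ge k (F k).

Lemma fps_seriesE F N n : fps_summable F -> (n < N)%N ->
  fps_series F n = \sum_(k < N) F k n.
Proof.
move=> sF nN; rewrite /fps_series (big_ord_widen _ (fun k => F k n) nN).
rewrite big_mkcond; apply: eq_bigr => k _; case: ltnP => // nk.
by rewrite sF.
Qed.

Lemma fps_summableMl (G : nat -> fps A) F :
  fps_summable F -> fps_summable (fun k => G k * F k).
Proof. by move=> sF k; rewrite -[k]add0n; apply: fps_order_geM. Qed.

Lemma fps_series_recl F : fps_summable F ->
  fps_series F = F 0%N + fps_series (F \o succn).
Proof.
move=> sF; apply/funext => n; rewrite fpsD {1}/fps_series big_ord_recl.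
congr (_ + _); rewrite (@fps_seriesE _ n.+1)//; last first.
  by move=> k i ik; apply: sF; exact: ltnW.
by rewrite big_ord_recr/= [X in _ = _ + X]sF// addr0.
Qed.

Lemma fps_seriesMl f F : fps_summable F ->
  f * fps_series F = fps_series (fun k => f * F k).
Proof.
move=> sF; apply/funext => n; rewrite fpsM [RHS](exchange_big)/=.
apply: eq_bigr => j _; rewrite (@fps_seriesE _ n.+1) ?mulr_sumr//.
by rewrite ltnS leq_subr.
Qed.

Lemma fps_seriesMr f F : fps_summable F ->
  fps_series F * f = fps_series (fun k => F k * f).
Proof.
move=> sF; apply/funext => n; rewrite fpsM [RHS](exchange_big)/=.
apply: eq_bigr => j _; rewrite (@fps_seriesE _ n.+1) ?mulr_suml//.
Qed.

(** The inverse is the geometric series of [1 - f]; it commutes with [f], so it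
    is two-sided although [A] need not be commutative. *)
Lemma fps_unitP f : f 0%N = 1 -> exists2 g, f * g = 1 & g * f = 1.
Proof.
move=> f0; pose e := 1 - f; pose F k := e ^+ k.
have e0 : e 0%N = 0 by rewrite /e fpsB fps1 f0 subrr.
have sF : fps_summable F by move=> k; exact: fps_order_geX.
exists (fps_series F).
- rewrite -[f](subKr 1) -/e mulrBl mul1r fps_seriesMl// {1}fps_series_recl//.
  by rewrite (_ : F \o succn = fun k => e * F k) ?addrK//;
    apply/funext => k /=; rewrite /F exprS.
- rewrite -[f](subKr 1) -/e mulrBr mulr1 fps_seriesMr// {1}fps_series_recl//.
  by rewrite (_ : F \o succn = fun k => F k * e) ?addrK//;
    apply/funext => k /=; rewrite /F exprSr.
Qed.

End FpsSeries.

Section FpsField.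
Context {K : fieldType}.
Implicit Types (f g : fps K).

(** Coefficient [n] of [f * g] is [f 0 * g n] plus a combination of earlier
    coefficients of [g]. *)
Lemma fps_mulI f g : f 0%N != 0 -> f * g = 0 -> g = 0.
Proof.
move=> f0 fg; apply/funext => n; elim/ltn_ind: n => n IH.
have := congr1 (@^~ n) fg; rewrite fpsM big_ord_recl big1 => [|j _]; last first.
  by rewrite IH ?mulr0// /bump/= ltn_subrL (leq_ltn_trans _ (ltn_ord j)).
by rewrite addr0 subn0 => /eqP; rewrite mulf_eq0 (negbTE f0) => /eqP.
Qed.

End FpsField.

Section FpsComp.
Context {C : comNzRingType} (v : fps C).
Implicit Types (f g : fps C).

(** The composition [f(v(u))]; it is the expected one when [v] has no constant
    term. *)
Definition fps_comp f : fps C := fps_series (fun k => fpsC (f k) * v ^+ k).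

Hypothesis v0 : v 0%N = 0.

Lemma fps_comp_summable f : fps_summable (fun k => fpsC (f k) * v ^+ k).
Proof. apply: (@fps_summableMl _ (fun k => fpsC (f k))) => k; exact: fps_order_geX. Qed.

Lemma fps_compN : {morph fps_comp : f / - f}.
Proof.
move=> f; apply/funext => n; rewrite fpsN /fps_comp /fps_series.
by rewrite -sumrN; apply: eq_bigr => k _; rewrite fpsN raddfN mulNr.
Qed.

Lemma fps_compD : {morph fps_comp : f g / f + g}.
Proof.
move=> f g; apply/funext => n; rewrite fpsD /fps_comp /fps_series.
by rewrite -big_split; apply: eq_bigr => k _; rewrite fpsD raddfD mulrDl.
Qed.

Lemma fps_comp_fpsC c : fps_comp (fpsC c) = fpsC c.
Proof.
rewrite /fps_comp fps_series_recl; last exact: fps_comp_summable.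
rewrite expr0 mulr1 (_ : fps_series _ = 0) ?addr0//; apply/funext => n.
by rewrite /fps_series big1// => k _ /=; rewrite raddf0 mul0r.
Qed.

Lemma fps_comp_fpsX : fps_comp fpsX = v.
Proof.
rewrite /fps_comp fps_series_recl; last exact: fps_comp_summable.
rewrite fps_series_recl; last first.
  by move=> k i ik; apply: fps_comp_summable; exact: ltnW.
rewrite /= raddf0 mul0r add0r rmorph1 mul1r expr1 (_ : fps_series _ = 0).
  by rewrite addr0.
apply/funext => n.
by rewrite /fps_series big1// => k _ /=; rewrite raddf0 mul0r.
Qed.

Lemma fps_comp_trunc f N n : (n < N)%N ->
  fps_comp f n = (\poly_(k < N) fpsC (f k)).[v] n.
Proof.
move=> nN; rewrite horner_poly fps_sum.
by rewrite -(fps_seriesE (fps_comp_summable f) nN).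
Qed.

(** Up to degree [n] the compositions are the values at [v] of truncated
    polynomials, and evaluation is multiplicative; the terms that the product of
    the truncations has in excess start beyond degree [n]. *)
Lemma fps_compM : {morph fps_comp : f g / f * g}.
Proof.
move=> f g; apply/funext => n.
set T : fps C -> {poly fps C} := fun f => \poly_(k < n.+1) fpsC (f k).
have TE h i : (i < n.+1)%N -> (T h)`_i = fpsC (h i).
  by rewrite coef_poly => ->.
transitivity ((T f * T g).[v] n); last first.
  rewrite hornerM 2!fpsM; apply: eq_bigr => j _.
  by rewrite !(@fps_comp_trunc _ n.+1)// ltnS leq_subr.
rewrite (horner_coef_wide (n := n.+1 + n.+1)); last first.
  rewrite (leq_trans (size_polyMleq (T f) (T g)))// (leq_trans (leq_pred _))//.
  by rewrite leq_add ?size_poly.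
rewrite fps_sum big_split_ord/= [X in _ = _ + X]big1 ?addr0 => [|k _].
  rewrite /fps_comp /fps_series; apply: eq_bigr => k _; congr ((_ * _ : fps C) n).
  rewrite coefM fpsM rmorph_sum; apply: eq_bigr => j _.
  have jn : (j < n.+1)%N by rewrite (leq_trans (ltn_ord j)).
  by rewrite rmorphM !TE// ltnS (leq_trans (leq_subr _ _))// -ltnS.
have := fps_order_geM (_ : fps_order_ge 0 (T f * T g)`_(n.+1 + k)%N)
  (@fps_order_geX _ v (n.+1 + k)%N v0).
by apply=> //; exact: leq_addr.
Qed.

End FpsComp.

Lemma fps_comp_id (C : comNzRingType) (f : fps C) : fps_comp fpsX f = f.
Proof.
have XE k n : (fpsX ^+ k : fps C) n = (n == k)%:R.
  by elim: k n => [|k IH] [|n] //; rewrite exprS fpsXM// IH.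
apply/funext => n; rewrite /fps_comp /fps_series big_ord_recr big1/= => [|k _].
  by rewrite add0r fpsCM XE eqxx mulr1.
by rewrite fpsCM XE gtn_eqF ?mulr0.
Qed.

Section FpsMap.
Context {A B : nzRingType} (f : {rmorphism A -> B}).

Definition fps_map (F : fps A) : fps B := fun n => f (F n).

Fact fps_map_is_additive : {morph fps_map : F G / F - G}.
Proof. by move=> F G; apply/funext => n; rewrite /fps_map !fpsB rmorphB. Qed.

HB.instance Definition _ := GRing.isZmodMorphism.Build (fps A) (fps B) fps_map
  fps_map_is_additive.

Fact fps_map_is_multiplicative : monoid_morphism fps_map.
Proof.
split; first by apply/funext => n; rewrite /fps_map !fps1 rmorph_nat.
move=> F G; apply/funext => n; rewrite /fps_map !fpsM rmorph_sum.
by apply: eq_bigr => j _; rewrite rmorphM.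
Qed.

HB.instance Definition _ := GRing.isMonoidMorphism.Build (fps A) (fps B) fps_map
  fps_map_is_multiplicative.

Lemma fps_map_fpsC a : fps_map (fpsC a) = fpsC (f a).
Proof. by apply/funext => -[|n]; rewrite /fps_map /fpsC/= ?rmorph0. Qed.

Lemma fps_map_fpsX : fps_map fpsX = fpsX.
Proof. by apply/funext => n; rewrite /fps_map /fpsX rmorph_nat. Qed.

End FpsMap.

(** * Additive free convolution *)

Section ScalarSeries.
Context {K : fieldType} {A : algType K}.
Implicit Types (f g : fps K) (F G : fps A).

Definition fps_alg f : fps A := fps_map (in_alg A) f.
HB.instance Definition _ :=
  GRing.RMorphism.copy fps_alg (fps_map (in_alg A)).

Lemma fps_algM f F n : (fps_alg f * F) n = \sum_(j < n.+1) f j *: F (n - j)%N.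
Proof. by rewrite fpsM; apply: eq_bigr => j _; rewrite /fps_alg /fps_map mulr_algl. Qed.

Lemma fps_alg_comm f F : fps_alg f * F = F * fps_alg f.
Proof.
apply/funext => n; rewrite fps_algM fpsM (reindex_inj rev_ord_inj)/=.
apply: eq_bigr => j _; rewrite subSS subKn; last by rewrite -ltnS.
by rewrite /fps_alg /fps_map mulr_algr.
Qed.

Context (phi : {scalar A}).

Definition fps_state F : fps K := fun n => phi (F n).

Lemma fps_stateB F G : fps_state (F - G) = fps_state F - fps_state G.
Proof. by apply/funext => n; rewrite /fps_state fpsB linearB. Qed.

Lemma fps_stateD F G : fps_state (F + G) = fps_state F + fps_state G.
Proof. by apply/funext => n; rewrite /fps_state fpsD linearD. Qed.

Lemma fps_stateM f F : fps_state (fps_alg f * F) = f * fps_state F.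
Proof.
apply/funext => n; rewrite /fps_state fps_algM linear_sum.
by rewrite fpsM; apply: eq_bigr => j _; rewrite linearZ.
Qed.

Definition moment_series (X : A) : fps K := fun n => phi (X ^+ n).

End ScalarSeries.

Section AlternatingWords.
Context {R : realType} {A : algType R[i]} (phi : {scalar A}).
Context (B : bool -> set A).
Implicit Types (b : bool) (a x y : A) (E F : fps A).

(** Products of centred letters taken in turn from [B true] and [B false]; the
    Boolean tells where the first letter lies. Freeness says that the state
    vanishes on them. *)
Inductive alt_word : bool -> A -> Prop :=
| AltLetter b a : B b a -> phi a = 0 -> alt_word b a
| AltCons b a x : B b a -> phi a = 0 -> alt_word (~~ b) x -> alt_word b (a * x).

(** Finite sums of words with the same type of first letter: this is what the
    coefficients of a product of series of letters are made of. *)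
Inductive alt_sum b : A -> Prop :=
| AltZero : alt_sum b 0
| AltAdd x y : alt_word b x -> alt_sum b y -> alt_sum b (x + y).

Lemma alt_word_sum b x : alt_word b x -> alt_sum b x.
Proof. by move=> bx; rewrite -[x]addr0; apply: AltAdd => //; exact: AltZero. Qed.

Lemma alt_sumD b x y : alt_sum b x -> alt_sum b y -> alt_sum b (x + y).
Proof.
elim=> [|x1 x2 bx _ IH] by_; first by rewrite add0r.
by rewrite -addrA; apply: AltAdd => //; exact: IH.
Qed.

Lemma alt_sumM b a x : B b a -> phi a = 0 -> alt_sum (~~ b) x ->
  alt_sum b (a * x).
Proof.
move=> Ba pa; elim=> [|x1 x2 bx _ IH]; first by rewrite mulr0; exact: AltZero.
by rewrite mulrDr; apply: AltAdd IH; exact: AltCons.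
Qed.

Lemma alt_word_letters b x : alt_word b x -> exists n (a : nat -> A),
  [/\ forall k, (k <= n)%N -> B (b (+) odd k) (a k),
      forall k, (k <= n)%N -> phi (a k) = 0
    & x = \prod_(0 <= k < n.+1) a k].
Proof.
elim=> {x} [{}b a Ba pa|{}b a x Ba pa _ [n [c [Bc pc ->]]]].
  exists 0%N, (fun=> a); split; last by rewrite big_nat1.
  - by move=> [|//] _; rewrite addbF.
  - by [].
exists n.+1, (fun k => if k is k'.+1 then c k' else a); split.
- move=> [_|k kn]; first by rewrite addbF.
  by have := Bc k kn; rewrite addNb /= addbN.
- by move=> [//|k] kn; exact: pc.
- by rewrite [RHS]big_nat_recl.
Qed.

Hypothesis freeB : free_family phi B.

Lemma alt_word_state b x : alt_word b x -> phi x = 0.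
Proof.
move=> /alt_word_letters[n [a [Ba pa ->]]].
apply: (freeB (i := fun k => b (+) odd k)) => // k _ /=.
by case: (odd k); case: (b).
Qed.

Lemma alt_sum_state b x : alt_sum b x -> phi x = 0.
Proof.
elim=> [|x1 x2 /alt_word_state px _ IH]; first exact: linear0.
by rewrite linearD/= px IH addr0.
Qed.

Definition fps_centred b E := forall n, B b (E n) /\ phi (E n) = 0.
Definition fps_alt b F := forall n, alt_sum b (F n).

Lemma fps_altM b E F : fps_centred b E -> fps_alt (~~ b) F -> fps_alt b (E * F).
Proof.
move=> cE aF n; rewrite fpsM; elim/big_rec: _ => [|j x _]; first exact: AltZero.
by apply: alt_sumD; have [BE pE] := cE j; exact: alt_sumM.
Qed.

Lemma fps_centred_alt b E : fps_centred b E -> fps_alt b E.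
Proof.
by move=> cE n; have [BE pE] := cE n; apply: alt_word_sum; exact: AltLetter.
Qed.

Lemma fps_alt_state b F : fps_alt b F -> fps_state phi F = 0.
Proof. by move=> aF; apply/funext => n; exact: (alt_sum_state (aF n)). Qed.

(** As [E1 * E2] has no constant term, the equation [F = H + E1 * E2 * F]
    expresses each coefficient of [F] through earlier ones, and alternation
    propagates by strong induction on the degree. *)
Lemma fps_alt_fixpoint b E1 E2 H F : fps_centred b E1 -> fps_centred (~~ b) E2 ->
  E1 0%N = 0 -> fps_alt b H -> F = H + E1 * E2 * F -> fps_alt b F.
Proof.
move=> cE1 cE2 E10 aH eF n; elim/ltn_ind: n => n IH.
rewrite eF fpsD; apply: alt_sumD; first exact: aH.
pose F' : fps A := fun k => if (k < n)%N then F k else 0.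
have -> : (E1 * E2 * F) n = (E1 * E2 * F') n.
  apply: (@fpsM_order _ n 1) => [[|//] _|i].
    by rewrite fpsM0 E10 mul0r.
  by rewrite addn1 /F' => ->.
rewrite -mulrA; apply: fps_altM => //; apply: fps_altM => // k.
rewrite negbK /F'; case: ifP => [/IH//|_]; exact: AltZero.
Qed.

(** With [Z] the inverse of [1 - E1 * E2], every term of the expansion of
    [(1 - E2) * Z * (1 - E1)] except [1] is an alternating product of [E1] and
    [E2], hence is killed by the state. *)
Lemma fps_free_inverse E1 E2 : phi 1 = 1 ->
  fps_centred true E1 -> fps_centred false E2 -> E1 0%N = 0 ->
  exists2 Z, (1 - E1 * E2) * Z = 1
           & fps_state phi ((1 - E2) * Z * (1 - E1)) = 1.
Proof.
move=> phi1 cE1 cE2 E10.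
have [|Z FZ _] := @fps_unitP _ (1 - E1 * E2).
  by rewrite fpsB fpsM0 E10 mul0r subr0.
exists Z => //.
have ZE : Z = 1 + E1 * E2 * Z by rewrite -{1}FZ mulrBl mul1r subrK.
pose U := Z - 1; pose V := Z * E1.
have aE12 : fps_alt true (E1 * E2).
  by apply: fps_altM => //; exact: fps_centred_alt.
have aU : fps_alt true U.
  apply: (fps_alt_fixpoint cE1 cE2 E10 aE12).
  by rewrite /U {1}ZE [1 + _]addrC addrK mulrBr mulr1 subrKC.
have aV : fps_alt true V.
  apply: (fps_alt_fixpoint cE1 cE2 E10 (fps_centred_alt cE1)).
  by rewrite /V {1}ZE mulrDl mul1r mulrA.
have -> : (1 - E2) * Z * (1 - E1) = 1 + U - V - (E2 + E2 * U - E2 * V).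
  rewrite -mulrA; have -> : Z * (1 - E1) = 1 + U - V by rewrite mulrBr mulr1 subrKC.
  by rewrite mulrBl mul1r mulrBr mulrDr mulr1.
clearbody U V; have state1 : fps_state phi 1 = 1.
  apply/funext => -[|n]; rewrite /fps_state !fps1//; exact: linear0.
rewrite !(fps_stateB, fps_stateD) state1 (fps_alt_state aU) (fps_alt_state aV).
rewrite (fps_alt_state (fps_centred_alt cE2)).
rewrite (fps_alt_state (fps_altM cE2 aU)) (fps_alt_state (fps_altM cE2 aV)).
by rewrite !(addr0, subr0).
Qed.

End AlternatingWords.

Section GeneratedAlgebra.
Context {R : realType} {A : algType R[i]}.
Implicit Types (x y : A) (S : set A).

(** Boolean membership, so that the closure lemmas for subalgebras apply. *)
Definition generated_pred S : {pred A} := fun x => `[< generated_alg S x >].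

Fact generated_pred_closed S : GRing.subalg_closed (generated_pred S).
Proof.
split=> [|c x y /asboolP Sx /asboolP Sy|x y /asboolP Sx /asboolP Sy];
  apply/asboolP => M MS; have [[M1 MD MM] _] := MS.
- by rewrite inE in M1.
- by have := MD c x y; rewrite !inE; apply; [exact: Sx|exact: Sy].
- by have := MM x y; rewrite !inE; apply; [exact: Sx|exact: Sy].
Qed.

HB.instance Definition _ S := GRing.isSubalgClosed.Build _ A
  (generated_pred S) (generated_pred_closed S).

End GeneratedAlgebra.

Section FreeSum.
Context {R : realType} {A : algType R[i]} (phi : {scalar A}).
Implicit Types (X Y : A) (k v w : fps R[i]).

(** [(1 - v X)^-1], expanded in powers of [X]. *)
Definition fps_resolvent X v : fps A :=
  fps_series (fun i => fps_alg (v ^+ i) * fpsC (X ^+ i)).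

Lemma fps_resolvent_summable X v : v 0%N = 0 ->
  fps_summable (fun i => fps_alg (v ^+ i) * fpsC (X ^+ i)).
Proof.
move=> v0 i n ni; rewrite fps_algM big1// => j _.
by rewrite fps_order_geX ?scale0r// (leq_ltn_trans _ ni)// -ltnS.
Qed.

Lemma fps_resolventE X v : v 0%N = 0 ->
  (1 - fps_alg v * fpsC X) * fps_resolvent X v = 1 /\
  fps_resolvent X v * (1 - fps_alg v * fpsC X) = 1.
Proof.
move=> v0; set x := fps_alg v * fpsC X.
have sX := fps_resolvent_summable X v0.
have xE i : fps_alg (v ^+ i) * fpsC (X ^+ i) = x ^+ i.
  elim: i => [|i IH]; first by rewrite !expr0 !rmorph1 mulr1.
  rewrite !exprS !rmorphM -IH /x -!mulrA; congr (_ * _).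
  by rewrite !mulrA fps_alg_comm.
have GE : fps_resolvent X v = 1 + fps_series (fun i => x ^+ i.+1).
  rewrite /fps_resolvent fps_series_recl// xE expr0; congr (_ + fps_series _).
  by apply/funext => i /=; rewrite xE.
split.
- rewrite mulrBl mul1r {2}/fps_resolvent fps_seriesMl// GE.
  under [X in _ - fps_series X]eq_fun do rewrite xE -exprS.
  by rewrite addrK.
- rewrite mulrBr mulr1 {2}/fps_resolvent fps_seriesMr// GE.
  under [X in _ - fps_series X]eq_fun do rewrite xE -exprSr.
  by rewrite addrK.
Qed.

Lemma fps_resolvent_state X v : 
  fps_state phi (fps_resolvent X v) = fps_comp v (moment_series phi X).
Proof.
apply/funext => n; rewrite /fps_state /fps_resolvent /fps_comp /fps_series.
rewrite linear_sum; apply: eq_bigr => i _.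
by rewrite fpsMC fpsCM mulr_algl linearZ/= mulrC.
Qed.

(** The series [k - v k X] equals [k (1 - v X)], and the state of its inverse is
    [k^-1 M_X(v) = 1]; hence that inverse is [1 - E] with [E] centred, and all
    coefficients of [E] are polynomials in [X]. *)
Lemma centred_resolvent X k v : phi 1 = 1 ->
  k 0%N = 1 -> v 0%N = 0 -> fps_comp v (moment_series phi X) = k ->
  exists2 E : fps A, [/\ E 0%N = 0,
      forall n, generated_alg [set X] (E n) & fps_state phi E = 0]
    & (fps_alg k - fps_alg (v * k) * fpsC X) * (1 - E) = 1 /\
      (1 - E) * (fps_alg k - fps_alg (v * k) * fpsC X) = 1.
Proof.
move=> phi1 k0 v0 Mk; have [h kh _] := fps_unitP k0.
have [G1 G2] := fps_resolventE X v0.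
set G := fps_resolvent X v in G1 G2.
have PE : fps_alg k - fps_alg (v * k) * fpsC X
    = fps_alg k * (1 - fps_alg v * fpsC X).
  by rewrite mulrBr mulr1 mulrA -rmorphM [k * v]mulrC.
exists (1 - fps_alg h * G).
- split.
  + have h0 : h 0%N = 1.
      by have := congr1 (@^~ 0%N) kh; rewrite fpsM0 k0 mul1r.
    have G0 : G 0%N = 1.
      by rewrite /G /fps_resolvent /fps_series big_ord1 !expr0 !rmorph1 mulr1.
    by rewrite fpsB fpsM0 /fps_alg /fps_map /= h0 G0 scale1r mulr1 subrr.
  + move=> n; apply/asboolP; change ((1 - fps_alg h * G) n \in generated_pred [set X]).
    rewrite fpsB fps_algM rpredB//.
      by rewrite fps1; case: eqP => _; rewrite ?rpred0 ?rpred1.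
    apply: rpred_sum => j _; apply: rpredZ.
    apply: rpred_sum => i _; rewrite fpsMC; apply: rpredM.
      by rewrite /fps_alg /fps_map /=; apply: rpredZ; exact: rpred1.
    by apply: rpredX; apply/asboolP; exact: sub_gen_smallest.
  + rewrite fps_stateB fps_stateM fps_resolvent_state Mk mulrC kh.
    apply/funext => -[|n]; rewrite fpsB /fps_state !fps1 ?phi1 ?subrr//.
    by rewrite linear0 subr0.
- rewrite subKr PE; split.
  + rewrite mulrA -[_ * fps_alg h]fps_alg_comm mulrA -rmorphM.
    by rewrite [h * k]mulrC kh rmorph1 mul1r G1.
  + rewrite mulrA -[_ * fps_alg k]fps_alg_comm mulrA -rmorphM.
    by rewrite kh rmorph1 mul1r G2.
Qed.

(** Additivity of the R-transform, in a form that involves no inversion of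
    series. Write [P = kX - u M X] and [Q = kY - u M Y], with inverses [1 - EX]
    and [1 - EY]. Then
      [P (1 - EX EY) Q = P + Q - 1 = M (1 - u (X + Y))],
    so that [M^-1 (1 - u (X + Y))^-1 = (1 - EY) (1 - EX EY)^-1 (1 - EX)], and by
    freeness the state of the right-hand side is [1]. *)
Theorem free_sum_moments X Y (kX kY vX vY M : fps R[i]) : phi 1 = 1 ->
  free_family phi (fun b : bool => generated_alg [set if b then X else Y]) ->
  kX 0%N = 1 -> kY 0%N = 1 -> vX 0%N = 0 -> vY 0%N = 0 ->
  fps_comp vX (moment_series phi X) = kX ->
  fps_comp vY (moment_series phi Y) = kY ->
  kX + kY - 1 = M -> vX * kX = fpsX * M -> vY * kY = fpsX * M ->
  moment_series phi (X + Y) = M.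
Proof.
move=> phi1 freeXY kX0 kY0 vX0 vY0 MX MY Mk vkX vkY.
have [EX [EX0 EXg EXs] []] := centred_resolvent phi1 kX0 vX0 MX.
have [EY [EY0 EYg EYs] []] := centred_resolvent phi1 kY0 vY0 MY.
rewrite vkX vkY.
set P := fps_alg kX - _; set Q := fps_alg kY - _ => QE EQ PE EP.
pose B b := generated_alg [set if b then X else Y].
have cX : fps_centred phi B true EX.
  by move=> n; split; [exact: EXg|by rewrite -[LHS]/(fps_state phi EX n) EXs].
have cY : fps_centred phi B false EY.
  by move=> n; split; [exact: EYg|by rewrite -[LHS]/(fps_state phi EY n) EYs].
have [Z FZ sZ] := fps_free_inverse freeXY phi1 cX cY EX0.
set N := (1 - EY) * Z * (1 - EX) in sZ.
have PQ : P * (1 - EX * EY) * Q = P + Q - 1.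
  have -> : 1 - EX * EY = (1 - EX) + (1 - EY) - (1 - EX) * (1 - EY).
    rewrite [(1 - EX) * _]mulrBr mulr1 [(1 - EX) * EY]mulrBl mul1r opprB.
    by rewrite [1 - EX + _]addrC addrACA subrr addr0 addrA subrK.
  move: PE EQ; set a := 1 - EX; set b := 1 - EY => Pa bQ.
  rewrite [P * _]mulrBr [P * (a + b)]mulrDr mulrA Pa mul1r mulrBl mulrDl mul1r.
  by rewrite bQ -mulrA bQ mulr1 [Q + P]addrC.
have PQS : P + Q - 1 = fps_alg M * (1 - fps_alg fpsX * fpsC (X + Y)).
  rewrite mulrBr mulr1 mulrA -rmorphM [M * _]mulrC raddfD mulrDr.
  have -> : fps_alg M = fps_alg kX + fps_alg kY - 1 :> fps A.
    by rewrite -Mk rmorphB rmorphD rmorph1.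
  by rewrite /P /Q addrACA -opprD [LHS]addrAC.
have X0 : (fpsX : fps R[i]) 0%N = 0 by [].
have [_ G2] := fps_resolventE (X + Y) X0.
have MN : fps_alg M * N = fps_resolvent (X + Y) fpsX.
  rewrite -[LHS]mul1r -G2 -!mulrA.
  suff -> : (1 - fps_alg fpsX * fpsC (X + Y)) * (fps_alg M * N) = 1.
    by rewrite mulr1.
  rewrite mulrA -fps_alg_comm -PQS -PQ /N -!mulrA (mulrA Q) QE mul1r.
  by rewrite (mulrA (1 - _ * _)) FZ mul1r PE.
transitivity (fps_comp fpsX (moment_series phi (X + Y))).
  by rewrite fps_comp_id.
by rewrite -fps_resolvent_state -MN fps_stateM sZ mulr1.
Qed.

End FreeSum.

(** * Quadratic equations for moment series *)

Section Euler.
Context {K : numFieldType}.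
Implicit Types (f g : fps K).

(** The derivation [u d/du], which keeps the index of each coefficient. *)
Definition fps_euler f : fps K := fun n => n%:R * f n.

Lemma fps_eulerM f g : fps_euler (f * g) = fps_euler f * g + f * fps_euler g.
Proof.
apply/funext => n; rewrite fpsD /fps_euler !fpsM mulr_sumr -big_split/=.
apply: eq_bigr => j _; have jn : (j <= n)%N by rewrite -ltnS.
by rewrite -{1}(subnKC jn) natrD; ring.
Qed.

Lemma fps_eulerB f g : fps_euler (f - g) = fps_euler f - fps_euler g.
Proof. by apply/funext => n; rewrite fpsB /fps_euler fpsB mulrBr. Qed.

(** Coefficient [n] of the equation is [n * q 0 * f n] plus earlier coefficients
    of [f]: a linear differential equation of order one that is regular at [0] has
    only the zero solution with value [0] there. *)
Lemma fps_euler_uniq (p q f : fps K) : q 0%N != 0 -> p 0%N = 0 ->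
  f 0%N = 0 -> q * fps_euler f = p * f -> f = 0.
Proof.
move=> q0 p0 f0 qf; apply/funext => n; elim/ltn_ind: n => -[//|n] IH.
rewrite fps0; have := congr1 (@^~ n.+1) qf; rewrite !fpsM.
rewrite [X in X = _]big_ord_recl [X in _ = X]big_ord_recl p0 mul0r add0r subn0.
rewrite [X in _ = X]big1 => [|j _]; last first.
  by rewrite IH ?mulr0// lift0 subSS ltnS leq_subr.
rewrite big1 => [|j _]; last first.
  by rewrite /fps_euler IH ?mulr0// lift0 subSS ltnS leq_subr.
rewrite addr0 => /eqP; rewrite /fps_euler !mulf_eq0 (negbTE q0) pnatr_eq0/=.
by move=> /eqP.
Qed.

(** For [J n] the moments of the density [sqrt ((x - a) (b - x)) / (2 pi)] and
    [m = (a + b) / 2] this is the expansion of [sqrt ((1 - a u) (1 - b u))]: the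
    Cauchy transform of that density is [(z - m - sqrt ((z - a) (z - b))) / 2],
    to be read at [z = 1 / u]. *)
Definition sqrt_series (m : K) (J : fps K) : fps K :=
  1 - fpsC m * fpsX - 2 * fpsX ^+ 2 * J.

(** The recursion for [J] is the differential equation [2 q (u D') = (u q') D] of
    [D = sqrt q], with [q] the right-hand side. Hence [D ^+ 2] and [q] solve the
    same linear equation and have the same constant term. *)
Lemma sqrt_series_sqr m s2 (J : fps K) :
  4 * J 0%N = m ^+ 2 - s2 -> J 1%N = m * J 0%N ->
  (forall n, n.+4%:R * J n.+2 =
     (n.*2 + 5)%:R * m * J n.+1 - n.+1%:R * s2 * J n) ->
  sqrt_series m J ^+ 2 = 1 - fpsC (2 * m) * fpsX + fpsC s2 * fpsX ^+ 2.
Proof.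
move=> J0 J1 Jrec; set D := sqrt_series m J; set q := (RHS).
have DE n : D n = if n is k.+1 then if k is l.+1 then - (2 * J l) else - m else 1.
  rewrite /D /sqrt_series expr2 -!mulrA !fpsB fps1 fpsCM.
  have -> : (2 : fps K) = fpsC 2 by rewrite rmorph_nat.
  by rewrite fpsCM; case: n => [|[|n]]; rewrite !fpsXM /fpsX/=; ring.
pose p : fps K := - fpsC (2 * m) * fpsX + fpsC (2 * s2) * fpsX ^+ 2.
have qM f n : (q * f) n = f n - (2 * m) * (if n is k.+1 then f k else 0)
   + s2 * (if n is k.+2 then f k else 0).
  rewrite /q mulrDl mulrBl mul1r expr2 -!mulrA !(fpsD, fpsN) !fpsCM.
  by case: n => [|[|n]]; rewrite !fpsXM; ring.
have pM f n : (p * f) n = - (2 * m) * (if n is k.+1 then f k else 0)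
   + 2 * s2 * (if n is k.+2 then f k else 0).
  rewrite /p mulrDl expr2 -!mulrA -rmorphN fpsD !fpsCM.
  by case: n => [|[|n]]; rewrite !fpsXM; ring.
have Dq : 2 * (q * fps_euler D) = p * D.
  apply/funext => n; have -> : (2 : fps K) = fpsC 2 by rewrite rmorph_nat.
  rewrite fpsCM qM pM /fps_euler; case: n => [|[|[|[|n]]]]; rewrite !DE.
  - by ring.
  - by ring.
  - by rewrite -[s2](subKr (m ^+ 2)) -J0; ring.
  - by rewrite J1; ring.
  - apply/eqP; rewrite -subr_eq0; apply/eqP; have := Jrec n.
    rewrite -mul2n => Jn; transitivity (- 4 * (n.+4%:R * J n.+2
      - ((2 * n + 5)%:R * m * J n.+1 - n.+1%:R * s2 * J n))); first by ring.
    by rewrite Jn subrr mulr0.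
have q0 : q 0%N = 1 by rewrite -[q]mulr1 qM fps1/=; ring.
have q1 : fps_euler q = p.
  apply/funext => n; rewrite /fps_euler -[q]mulr1 -[p]mulr1 qM pM.
  by case: n => [|[|[|n]]]; rewrite !fps1/=; ring.
apply/eqP; rewrite -subr_eq0; apply/eqP.
apply: (@fps_euler_uniq p q) => //.
- by rewrite q0 oner_neq0.
- by rewrite -[p]mulr1 pM; ring.
- by rewrite fpsB expr2 fpsM0 DE q0; ring.
rewrite fps_eulerB q1 mulrBr mulrBr [p * q]mulrC; congr (_ - _).
rewrite expr2 fps_eulerM [in RHS]mulrA -Dq; ring.
Qed.

(** [(2 u M - P) ^+ 2 = Q ^+ 2 q] is [4 u] times the conclusion. *)
Lemma quadratic_of_sqrt (P Q M D q : fps K) (N : fps K) :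
  2 * fpsX * M = P - Q * D -> D ^+ 2 = q ->
  P ^+ 2 - Q ^+ 2 * q = 4 * fpsX * N ->
  fpsX * M ^+ 2 - P * M + N = 0.
Proof.
move=> MD Dq PQ; apply: fpsX_inj => /=; rewrite mulr0.
have E : 4 * (fpsX * (fpsX * M ^+ 2 - P * M + N)) = 0.
  transitivity ((2 * fpsX * M - P) ^+ 2 - (P ^+ 2 - 4 * fpsX * N)); first by ring.
  by rewrite MD -PQ -Dq; ring.
apply: fps_mulI E.
have -> : (4 : fps K) = fpsC 4 by rewrite rmorph_nat.
by rewrite pnatr_eq0.
Qed.

End Euler.

Section Subordination.
Context {K : numFieldType}.
Implicit Types (M : fps K).

(** With [v = 1 / z] and [M = z G(z)], the quadratic equation satisfied by the
    Cauchy transform [G] of a free GIG law, [delta] standing for the coefficient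
    that depends on the endpoints of the support. For [beta = delta = 0] it is the
    equation of the free Poisson law with rate [lambda] and jump [1 / alpha]. *)
Definition gig_equation (lambda alpha beta delta : K) (v M : fps K) : Prop :=
  v * M ^+ 2 - (fpsC alpha + fpsC (1 - lambda) * v - fpsC beta * v ^+ 2) * M
  + fpsC alpha + fpsC delta * v = 0.

Lemma gig_equation_comp lambda alpha beta delta (v M : fps K) : v 0%N = 0 ->
  gig_equation lambda alpha beta delta fpsX M ->
  gig_equation lambda alpha beta delta v (fps_comp v M).
Proof.
move=> v0 /(congr1 (fps_comp v)); rewrite /gig_equation !expr2.
rewrite !(fps_compD, fps_compN, fps_compM v0, fps_comp_fpsC v0).
rewrite (fps_comp_fpsX v0) => ->.
by rewrite -[0](raddf0 fpsC) fps_comp_fpsC ?raddf0.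
Qed.

(** The difference of two solutions is annihilated by a series with constant term
    [- alpha]. *)
Lemma gig_equation_uniq lambda alpha beta delta (v M N : fps K) : alpha != 0 ->
  v 0%N = 0 -> gig_equation lambda alpha beta delta v M ->
  gig_equation lambda alpha beta delta v N -> M = N.
Proof.
move=> a0 v0 hM hN; apply/eqP; rewrite -subr_eq0; apply/eqP.
pose f := v * (M + N) - (fpsC alpha + fpsC (1 - lambda) * v - fpsC beta * v ^+ 2).
apply: (@fps_mulI _ f).
  rewrite /f !(fpsB, fpsD) !fpsM0 expr2 fpsM0 v0 !(mulr0, mul0r, addr0, subr0).
  by rewrite sub0r oppr_eq0.
transitivity ((0 : fps K) - 0); last by rewrite subr0.
by rewrite -{1}hM -hN /f; ring.
Qed.

(** With [w = u M] in the role of the common value of the three Cauchy transforms,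
    [c / u] is the R-transform [lambda / (alpha - w)] of the free Poisson law, and
    subtracting it from [1 / u] turns the equation for [lambda] into the one for
    [- lambda]. So [vX], [vY] are the subordination functions: [kX = w / vX] and
    [kY = w / vY]. *)
Lemma gig_subordination (lambda alpha beta delta : K) (MX MY M : fps K) :
  alpha != 0 -> M 0%N = 1 ->
  gig_equation (- lambda) alpha beta delta fpsX MX ->
  gig_equation lambda alpha 0 0 fpsX MY ->
  gig_equation lambda alpha beta (delta - lambda) fpsX M ->
  exists kX kY vX vY : fps K,
    [/\ kX 0%N = 1, kY 0%N = 1, vX 0%N = 0 & vY 0%N = 0] /\
    [/\ fps_comp vX MX = kX, fps_comp vY MY = kY, kX + kY - 1 = M,
        vX * kX = fpsX * M & vY * kY = fpsX * M].
Proof.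
move=> a0 M0 hX hY hM.
have [|g gE _] := @fps_unitP _ (1 - fpsC alpha^-1 * (fpsX * M)).
  by rewrite fpsB !fpsM0 mul0r mulr0 subr0.
pose c := fpsC (lambda / alpha) * fpsX * g.
have cE : c * (fpsC alpha - fpsX * M) = fpsC lambda * fpsX.
  rewrite /c -[RHS]mulr1 -gE.
  have aV : fpsC alpha * fpsC alpha^-1 = 1 :> fps K by rewrite -rmorphM divff// rmorph1.
  have -> : fpsC lambda = fpsC (lambda / alpha) * fpsC alpha.
    by rewrite -rmorphM divfK.
  transitivity (fpsC (lambda / alpha) * fpsX * g *
    (fpsC alpha - fpsC alpha * fpsC alpha^-1 * (fpsX * M))); last by ring.
  by rewrite aV mul1r.
have c0 : c 0%N = 0 by rewrite /c !fpsM0 mulr0 mul0r.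
clearbody c; pose t := 1 - c.
have [|d td _] := @fps_unitP _ t; first by rewrite /t fpsB c0 subr0.
pose kY := 1 + c * M.
have kY0 : kY 0%N = 1 by rewrite /kY fpsD fpsM0 c0 mul0r addr0.
have [e ke _] := fps_unitP kY0.
exists (t * M), kY, (fpsX * d), (fpsX * M * e).
have vX0 : (fpsX * d) 0%N = 0 by rewrite fpsM0 mul0r.
have vY0 : (fpsX * M * e) 0%N = 0 by rewrite !fpsM0 !mul0r.
split; first by split => //; rewrite fpsM0 M0 mulr1 /t fpsB c0 subr0.
split.
- apply: (gig_equation_uniq a0 vX0 (gig_equation_comp vX0 hX)).
  rewrite /gig_equation; set v := fpsX * d.
  have vt : v * t = fpsX by rewrite /v -mulrA [d * t]mulrC td mulr1.
  apply: (@fps_mulI _ t); first by rewrite /t fpsB c0 subr0 oner_neq0.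
  transitivity ((v * t) * (t * M) ^+ 2 - fpsC alpha * t ^+ 2 * M
    - fpsC (1 + lambda) * (v * t) * t * M + fpsC beta * (v * t) ^+ 2 * M
    + fpsC alpha * t + fpsC delta * (v * t)); first by ring.
  rewrite vt /t.
  transitivity ((fpsX * M ^+ 2 - (fpsC alpha + fpsC (1 - lambda) * fpsX
    - fpsC beta * fpsX ^+ 2) * M + fpsC alpha + fpsC (delta - lambda) * fpsX)
    + (c * (fpsC alpha - fpsX * M) - fpsC lambda * fpsX) * ((1 - c) * M + M - 1)).
    by ring.
  by rewrite hM cE subrr mul0r addr0.
- apply: (gig_equation_uniq a0 vY0 (gig_equation_comp vY0 hY)).
  rewrite /gig_equation; set v := fpsX * M * e.
  have vk : v * kY = fpsX * M by rewrite /v -mulrA [e * _]mulrC ke mulr1.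
  transitivity ((v * kY) * kY - fpsC alpha * kY - fpsC (1 - lambda) * (v * kY)
    + fpsC alpha); first by ring.
  rewrite vk /kY.
  transitivity (- M * (c * (fpsC alpha - fpsX * M) - fpsC lambda * fpsX)).
    by ring.
  by rewrite cE subrr mulr0.
- by rewrite /t /kY; ring.
- by rewrite mulrA -[fpsX * d * t]mulrA [d * t]mulrC td mulr1.
- by rewrite -mulrA [e * _]mulrC ke mulr1.
Qed.

End Subordination.

Lemma gig_equation_map {K L : numFieldType} (f : {rmorphism K -> L})
    (lambda alpha beta delta : K) (v M : fps K) :
  gig_equation lambda alpha beta delta v M ->
  gig_equation (f lambda) (f alpha) (f beta) (f delta) (fps_map f v) (fps_map f M).
Proof.
move=> H; rewrite /gig_equation; transitivity (fps_map f (v * M ^+ 2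
    - (fpsC alpha + fpsC (1 - lambda) * v - fpsC beta * v ^+ 2) * M
    + fpsC alpha + fpsC delta * v)); last by rewrite H rmorph0.
by rewrite !(rmorphD, rmorphN, rmorphM, rmorphXn, rmorph1)/= !fps_map_fpsC.
Qed.

Section MomentEquations.
Context {K : numFieldType}.
Implicit Types (M J : fps K).

(** The recursion for the moments of [sqrt ((x - a) (b - x)) / (2 pi)], where [m]
    is the midpoint of [a] and [b], and [s2 = a b]. *)
Definition semicircle_moments (m s2 : K) J : Prop :=
  [/\ 4 * J 0%N = m ^+ 2 - s2, J 1%N = m * J 0%N &
    forall n, n.+4%:R * J n.+2 =
      (n.*2 + 5)%:R * m * J n.+1 - n.+1%:R * s2 * J n].

Definition gig_delta (lambda alpha beta s m : K) : K :=
  ((1 - lambda) ^+ 2 - 2 * alpha * beta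
   - (alpha ^+ 2 * s ^+ 2 - 4 * alpha * (beta / s) * m + (beta / s) ^+ 2)) / 4.

(** The closed form of the Cauchy transform is [2 u M = P - Q D], with [D] the
    square root of [q] and [P], [Q] polynomials in [u]. The equations for the
    endpoints give its coefficient of [u], and they make the coefficients of [u]
    and [u ^+ 3] in [P ^+ 2 - Q ^+ 2 q] equal to [4 alpha] and [0]. *)
Lemma gig_moment_equation (lambda alpha beta s m j1 j2 : K) J M : s != 0 ->
  1 - lambda + alpha * s - beta * (m / s ^+ 2) = 0 ->
  1 + lambda + beta / s - alpha * m = 0 ->
  semicircle_moments m (s ^+ 2) J ->
  2 * j1 = m - s -> s * j2 = j1 ->
  M 0%N = alpha * j1 + beta / s * j2 ->
  M 1%N = alpha * J 0%N + beta / s * j1 ->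
  (forall n, M n.+2 = alpha * J n.+1 + beta / s * J n) ->
  gig_equation lambda alpha beta (gig_delta lambda alpha beta s m) fpsX M.
Proof.
move=> s0 e1 e2 [J0 J1 Jrec] j1E j2E M0 M1 M2.
have Dq := sqrt_series_sqr J0 J1 Jrec.
move: e1 e2 M0 M1 M2; rewrite /gig_delta; set c := beta / s => e1 e2 M0 M1 M2.
have bE : beta = c * s by rewrite divfK.
have {}e1 : s * (1 - lambda) + alpha * s ^+ 2 - c * m = 0.
  by rewrite -[0](mulr0 s) -e1 bE; field.
rewrite bE; set d := (_ / 4); clearbody c; clear bE.
have ME : M = fpsC alpha * (fpsC j1 + fpsX * J)
    + fpsC c * (fpsC j2 + fpsC j1 * fpsX + fpsX ^+ 2 * J).
  apply/funext => n; rewrite fpsD !fpsCM expr2 -mulrA 3!fpsD.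
  case: n => [|[|n]]; rewrite !(fpsXM, fpsCM) /fpsC/=.
  - by rewrite M0 /fpsX/=; ring.
  - by rewrite M1 /fpsX/=; ring.
  - by rewrite M2 /fpsX/=; ring.
have MD : 2 * fpsX * M = (fpsC alpha + fpsC (1 - lambda) * fpsX
    - fpsC (c * s) * fpsX ^+ 2) - (fpsC alpha + fpsC c * fpsX) * sqrt_series m J.
  rewrite /sqrt_series ME.
  transitivity (fpsC (alpha * (2 * j1) + c * (2 * j2)) * fpsX
    + fpsC (c * (2 * j1)) * fpsX ^+ 2
    + 2 * fpsX ^+ 2 * J * (fpsC alpha + fpsC c * fpsX)); first by ring.
  transitivity (fpsC (1 - lambda - c + alpha * m) * fpsX
    + fpsC (c * (m - s)) * fpsX ^+ 2
    + 2 * fpsX ^+ 2 * J * (fpsC alpha + fpsC c * fpsX)); last by ring.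
  rewrite j1E; congr (fpsC _ * _ + _ + _); apply: (mulfI s0).
  transitivity (s * alpha * (m - s) + c * (2 * (s * j2))); first by ring.
  rewrite j2E j1E; apply/eqP; rewrite -subr_eq0 -oppr_eq0 -e1; apply/eqP; ring.
rewrite /gig_equation -addrA; apply: (quadratic_of_sqrt MD Dq).
have d4 : 4 * fpsC d = fpsC ((1 - lambda) ^+ 2 - 2 * alpha * (c * s)
   - (alpha ^+ 2 * s ^+ 2 - 4 * alpha * c * m + c ^+ 2)) :> fps K.
  have -> : (4 : fps K) = fpsC 4 by rewrite rmorph_nat.
  by rewrite -rmorphM; congr fpsC; rewrite mulrC divfK// pnatr_eq0.
transitivity (4 * fpsX * fpsC alpha + 4 * fpsC d * fpsX ^+ 2
  - 2 * fpsC alpha * fpsC (1 + lambda + c - alpha * m) * fpsX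
  - 2 * fpsC c * fpsC (s * (1 - lambda) + alpha * s ^+ 2 - c * m) * fpsX ^+ 3).
  by rewrite d4; ring.
by rewrite e1 e2 raddf0; ring.
Qed.

Lemma poisson_moment_equation (lambda alpha m s2 : K) J M :
  alpha * m = 1 + lambda -> alpha ^+ 2 * s2 = (1 - lambda) ^+ 2 ->
  semicircle_moments m s2 J ->
  M 0%N = 1 -> (forall n, M n.+1 = alpha * J n) ->
  gig_equation lambda alpha 0 0 fpsX M.
Proof.
move=> e1 e2 [J0 J1 Jrec] M0 M1.
have Dq := sqrt_series_sqr J0 J1 Jrec.
have ME : M = 1 + fpsC alpha * (fpsX * J).
  apply/funext => n; rewrite fpsD fpsCM fpsXM fps1.
  by case: n => [|n]; rewrite ?M0 ?M1/=; ring.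
rewrite /gig_equation -addrA; apply: (quadratic_of_sqrt (Q := fpsC alpha) _ Dq).
  rewrite ME /sqrt_series.
  transitivity (2 * fpsX + 2 * fpsC alpha * fpsX ^+ 2 * J); first by ring.
  transitivity (fpsC (1 - lambda + alpha * m) * fpsX
    + 2 * fpsC alpha * fpsX ^+ 2 * J); last by ring.
  by rewrite e1; ring.
transitivity (2 * fpsC alpha * fpsC (1 - lambda + alpha * m) * fpsX
  + fpsC ((1 - lambda) ^+ 2 - alpha ^+ 2 * s2) * fpsX ^+ 2); first by ring.
by rewrite e1 e2; ring.
Qed.

End MomentEquations.

(** * Integrals against a semicircle density *)

Section SegmentIntegral.
Context {R : realType} (a b : R).
Hypothesis ab : a < b.
Local Open Scope classical_set_scope.
Notation mu := (@lebesgue_measure R).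
Notation cont f := {within `[a, b], continuous (f : R -> R)}.
Implicit Types f g F : R -> R.

Lemma cont_continuous f : continuous f -> cont f.
Proof. exact: continuous_subspaceT. Qed.

Lemma contM f g : cont f -> cont g -> cont (fun x => f x * g x).
Proof.
move=> /subspace_continuousP cf /subspace_continuousP cg.
by apply/subspace_continuousP => x xab; apply: cvgM; [exact: cf|exact: cg].
Qed.

Lemma contD f g : cont f -> cont g -> cont (fun x => f x + g x).
Proof.
move=> /subspace_continuousP cf /subspace_continuousP cg.
by apply/subspace_continuousP => x xab; apply: cvgD; [exact: cf|exact: cg].
Qed.

Lemma cont_cst c : cont (fun=> c).
Proof. by apply: cont_continuous => x; exact: cvg_cst. Qed.

Lemma contX n : cont (fun x => x ^+ n).
Proof. by apply: cont_continuous => x; exact: exprn_continuous. Qed.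

Lemma contV : 0 < a -> cont (fun x => x^-1).
Proof.
move=> a0; apply/subspace_continuousP => x; rewrite /= in_itv/= => /andP[ax _].
apply: cvg_within_filter; apply: cvgV; last exact: cvg_id.
by rewrite gt_eqF// (lt_le_trans a0).
Qed.

Lemma cont_integrable f : cont f -> mu.-integrable `[a, b] (EFin \o f).
Proof. by apply: continuous_compact_integrable; exact: segment_compact. Qed.

Lemma Rintegral_FTC f F : cont f -> cont F ->
  (forall x, a < x < b -> is_derive x 1 F (f x)) ->
  \int[mu]_(x in `[a, b]) f x = F b - F a.
Proof.
move=> cf /(continuous_within_itvP _ ab)[_ cFa cFb] dF.
rewrite /Rintegral (@continuous_FTC2 _ f F)//.
- split=> // x; rewrite in_itv/= => /dF dx; exact: ex_derive.
- by move=> x; rewrite in_itv/= => /dF dx; rewrite derive1E derive_val.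
Qed.

Definition semicircle x : R := Num.sqrt ((x - a) * (b - x)).

Lemma semicircle_continuous : continuous semicircle.
Proof.
move=> x; apply: (@continuous_comp _ _ _ (fun x => (x - a) * (b - x)) Num.sqrt);
  last exact: sqrt_continuous.
by apply: cvgM; apply: cvgB; by [exact: cvg_id|exact: cvg_cst].
Qed.

(** Normalised as the densities of the free GIG and free Poisson laws are, so the
    mass of the semicircle is [(b - a) ^+ 2 / 16]. *)
Definition semicircle_int f : R :=
  (2 * pi)^-1 * \int[mu]_(x in `[a, b]) (f x * semicircle x).

Lemma contw f : cont f -> cont (fun x => f x * semicircle x).
Proof. by move=> cf; apply: contM => //; exact/cont_continuous/semicircle_continuous. Qed.

Lemma eq_semicircle_int f g : (forall x, a <= x <= b -> f x = g x) ->
  semicircle_int f = semicircle_int g.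
Proof.
move=> fg; congr (_ * _); apply: eq_Rintegral => x.
by rewrite inE/= in_itv/= => /fg ->.
Qed.

Lemma semicircle_intD f g : cont f -> cont g ->
  semicircle_int (fun x => f x + g x) = semicircle_int f + semicircle_int g.
Proof.
move=> cf cg; rewrite /semicircle_int -mulrDr; congr (_ * _).
rewrite -RintegralD//; [|exact/cont_integrable/contw..].
by apply: eq_Rintegral => x _; rewrite mulrDl.
Qed.

Lemma semicircle_intZ c f : cont f ->
  semicircle_int (fun x => c * f x) = c * semicircle_int f.
Proof.
move=> cf; rewrite /semicircle_int mulrCA; congr (_ * _).
rewrite -RintegralZl//; last exact/cont_integrable/contw.
by apply: eq_Rintegral => x _; rewrite mulrA.
Qed.

(** The integrand is the derivative of [f * q `^ (3 / 2)], where
    [q = (x - a) (b - x)] vanishes at both endpoints. *)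
Lemma semicircle_int_parts f g : cont f -> cont g ->
  (forall x, a < x < b -> is_derive x 1 f (g x)) ->
  semicircle_int (fun x => g x * ((x - a) * (b - x))
    + f x * (3 / 2 * (a + b - 2 * x))) = 0.
Proof.
move=> cf cg df; rewrite /semicircle_int.
pose q x : R := (x - a) * (b - x).
have cq : cont q.
  by apply: cont_continuous => x; apply: cvgM; apply: cvgB;
    by [exact: cvg_id|exact: cvg_cst].
pose F x := f x * (q x * semicircle x).
pose h x := (g x * q x + f x * (3 / 2 * (a + b - 2 * x))) * semicircle x.
have ch : cont h.
  apply/contw/contD; first exact: contM.
  apply: contM => //; apply: cont_continuous => x.
  apply: cvgM; first exact: cvg_cst.
  by apply: cvgB; [exact: cvg_cst|apply: cvgM; [exact: cvg_cst|exact: cvg_id]].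
have cF : cont F by apply: contM => //; apply: contw.
have dF x : a < x < b -> is_derive x 1 F (h x).
  move=> /[dup] xab /andP[ax xb].
  have q0 : 0 < q x by rewrite mulr_gt0// subr_gt0.
  have dx := df x xab.
  have dq : is_derive x 1 q (a + b - 2 * x).
    by rewrite /q; apply: is_derive_eq; rewrite /GRing.scale/=; ring.
  have dw : is_derive x 1 semicircle ((2 * Num.sqrt (q x))^-1 * (a + b - 2 * x)).
    exact: (@is_derive1_comp R Num.sqrt q x _ _ (is_derive1_sqrt q0) dq).
  rewrite /F; apply: is_derive_eq.
  have w0 : semicircle x != 0.
    by rewrite /semicircle -/(q x) gt_eqF// sqrtr_gt0.
  have qE : q x = semicircle x ^+ 2 by rewrite sqr_sqrtr// ltW.
  rewrite /h -/(semicircle x) qE /GRing.scale/=; by field.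
by rewrite (Rintegral_FTC ch cF dF) /F /q !subrr !(mul0r, mulr0) subrr mulr0.
Qed.

End SegmentIntegral.

Section Substitution.
Context {R : realType}.
Local Open Scope classical_set_scope.
Notation mu := (@lebesgue_measure R).
Implicit Types (F G : R -> R) (a b : R).

Lemma Rintegral_substitution_decreasing F dF G a b : a < b ->
  {in `[a, b]%R &, {homo F : x y /~ x < y}} ->
  (forall x, a <= x <= b -> is_derive x 1 F (dF x)) ->
  (forall x, a <= x <= b -> {for x, continuous dF}) ->
  {within `[F b, F a], continuous G} ->
  \int[mu]_(x in `[F b, F a]) G x = \int[mu]_(x in `[a, b]) (G (F x) * - dF x).
Proof.
move=> ab decF derF cdF cG.
have FE x : a <= x <= b -> F^`() x = dF x.
  by move=> /derF dx; rewrite derive1E derive_val.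
have cF x : a <= x <= b -> {for x, continuous F}.
  by move=> /derF dx; apply/differentiable_continuous/derivable1_diffP.
have aab : a <= a <= b by rewrite lexx ltW.
have bab : a <= b <= b by rewrite lexx ltW.
rewrite /Rintegral integration_by_substitution_decreasing// ?ltW//.
- congr fine; apply: eq_integral => x; rewrite inE/= in_itv/= => xab.
  by rewrite fctE/= [in LHS]opprfctE FE.
- move=> x xab; have xab' : a <= x <= b.
    by move: xab; rewrite in_itv/= => /andP[ax xb]; rewrite !ltW.
  rewrite /prop_for /continuous_at FE//; apply: cvg_trans (cdF x xab').
  apply: near_eq_cvg; near=> y; rewrite FE//.
  have : y \in `]a, b[%R by near: y; exact: near_in_itvoo.
  by rewrite in_itv/= => /andP[ay yb]; rewrite !ltW.
- apply/cvg_ex; exists (dF a).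
  apply: cvg_trans (cvg_at_right_filter (cdF a aab)).
  apply: near_eq_cvg; near=> y; rewrite FE//.
  have ay : a < y by near: y; exact: nbhs_right_gt.
  have yb : y < b by near: y; exact: nbhs_right_lt.
  by rewrite !ltW.
- apply/cvg_ex; exists (dF b).
  apply: cvg_trans (cvg_at_left_filter (cdF b bab)).
  apply: near_eq_cvg; near=> y; rewrite FE//.
  have ay : a < y by near: y; exact: nbhs_left_gt.
  have yb : y < b by near: y; exact: nbhs_left_lt.
  by rewrite !ltW.
- split.
  + move=> x; rewrite in_itv/= => /andP[ax xb].
    have dx : is_derive x 1 F (dF x) by apply: derF; rewrite !ltW.
    exact: ex_derive.
  + exact/cvg_at_right_filter/cF.
  + exact/cvg_at_left_filter/cF.
Unshelve. all: by end_near. Qed.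

End Substitution.

Section SemicircleMoments.
Context {R : realType} (a b : R).
Hypothesis ab : a < b.
Local Open Scope classical_set_scope.
Notation mu := (@lebesgue_measure R).
Notation m := ((a + b) / 2).
Notation J := (semicircle_int a b).

(** Substitute [x = (a + b) / 2 + (b - a) / 2 * cos t]. *)
Lemma semicircle_int1 : J (fun=> 1) = (b - a) ^+ 2 / 16.
Proof.
pose r : R := (b - a) / 2.
have r0 : 0 < r by rewrite divr_gt0 ?subr_gt0.
pose F (t : R) := m + r * cos t; pose dF (t : R) := - (r * sin t).
have F0 : F 0 = b by rewrite /F cos0 /r; field.
have Fpi : F pi = a by rewrite /F cospi /r; field.
have decF : {in `[0, pi]%R &, {homo F : x y /~ x < y}}.
  by move=> x y x0 y0 xy; rewrite /F ltrD2l ltr_pM2l// ltr_cos.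
have derF x : 0 <= x <= pi -> is_derive x 1 F (dF x).
  by move=> _; rewrite /F /dF; apply: is_derive_eq; rewrite /GRing.scale/=; ring.
have cdF x : 0 <= x <= pi -> {for x, continuous dF}.
  move=> _; apply: cvgN; apply: cvgM; first exact: cvg_cst.
  exact: continuous_sin.
have cG : {within `[F pi, F 0], continuous (fun x => 1 * semicircle a b x)}.
  apply: continuous_subspaceT => x; apply: cvgM; first exact: cvg_cst.
  exact: semicircle_continuous.
have := Rintegral_substitution_decreasing (pi_gt0 R) decF derF cdF cG.
rewrite F0 Fpi /semicircle_int => ->.
pose h (t : R) := r ^+ 2 * sin t ^+ 2.
pose H (t : R) := r ^+ 2 / 2 * (t - sin t * cos t).
have ch : {within `[0, pi], continuous h}.
  apply: continuous_subspaceT => x; apply: cvgM; first exact: cvg_cst.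
  by apply: (@continuous_comp _ _ _ (@sin R) (fun x => x ^+ 2));
    [exact: continuous_sin|exact: exprn_continuous].
have cH : {within `[0, pi], continuous H}.
  apply: continuous_subspaceT => x; apply: cvgM; first exact: cvg_cst.
  apply: cvgB; first exact: cvg_id.
  by apply: cvgM; [exact: continuous_sin|exact: continuous_cos].
have dH x : 0 < x < pi -> is_derive x 1 H (h x).
  move=> _; rewrite /H /h; apply: is_derive_eq.
  transitivity (r ^+ 2 / 2 * (1 + sin x ^+ 2 - cos x ^+ 2)).
    by rewrite /GRing.scale/=; ring.
  by rewrite cos2sin2; field.
have pi0 : (pi : R) != 0 by rewrite gt_eqF// pi_gt0.
transitivity ((2 * pi)^-1 * \int[mu]_(x in `[0, pi]) h x).
  congr (_ * _); apply: eq_Rintegral => x.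
  rewrite inE/= in_itv/= => x0pi; rewrite mul1r /dF opprK /semicircle /F.
  rewrite [X in Num.sqrt X](_ : _ = (r * sin x) ^+ 2); last first.
    by rewrite exprMn sin2cos2 /r; field.
  rewrite sqrtr_sqr ger0_norm; first by rewrite /h; ring.
  by rewrite mulr_ge0 ?(ltW r0)// sin_ge0_pi.
rewrite (Rintegral_FTC (pi_gt0 R) ch cH dH) /H sinpi sin0 /r.
by move: pi0; generalize (pi : R) => p p0; field.
Qed.

(** Integration by parts with the functions [1] and [x ^+ n.+1]. *)
Lemma semicircle_int_recursion :
  semicircle_moments m (a * b) (fun n => J (fun x => x ^+ n)).
Proof.
have cX n := @contX R a b n.
have cM (f : R -> R) (c : R) : {within `[a, b], continuous f} ->
    {within `[a, b], continuous (fun x => c * f x)}.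
  by move=> cf; apply: contM => //; exact: cont_cst.
split.
- rewrite (_ : J _ = J (fun=> 1)); last first.
    by apply: eq_semicircle_int => x _; rewrite expr0.
  by rewrite semicircle_int1; field.
- have d x : a < x < b -> is_derive x 1 (fun=> 1 : R) (0 : R).
    by move=> _; exact: is_derive_cst.
  have := semicircle_int_parts ab (@cont_cst R a b 1) (@cont_cst R a b 0) d.
  rewrite (@eq_semicircle_int R a b _ (fun x => (3 * m) * x ^+ 0 + (- 3) * x ^+ 1)).
    rewrite (semicircle_intD (cM _ _ (cX 0%N)) (cM _ _ (cX 1%N))).
    rewrite !semicircle_intZ//.
    move=> E; apply: (@mulfI _ 3); first by rewrite pnatr_eq0.
    by apply/eqP; rewrite -subr_eq0 -oppr_eq0 -E; apply/eqP; ring.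
  by move=> x _; field.
- move=> n.
  have d x : a < x < b -> is_derive x 1 (fun x => x ^+ n.+1 : R) (n.+1%:R * x ^+ n).
    move=> _; apply: DeriveDef; first exact: exprn_derivable.
    by rewrite exp_derive /GRing.scale/= mulr1.
  have := semicircle_int_parts ab (cX n.+1) (cM _ n.+1%:R (cX n)) d.
  rewrite (@eq_semicircle_int R a b _ (fun x => (- n.+4%:R) * x ^+ n.+2 +
    ((n.*2 + 5)%:R * m * x ^+ n.+1 + (- (n.+1%:R * (a * b))) * x ^+ n))); last first.
    by move=> x _; rewrite -mul2n !exprS; field.
  rewrite (semicircle_intD (cM _ _ (cX _)) (contD (cM _ _ (cX _)) (cM _ _ (cX _)))).
  rewrite (semicircle_intD (cM _ _ (cX _)) (cM _ _ (cX _))) !semicircle_intZ//.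
  by move=> E; apply/eqP; rewrite -subr_eq0 -oppr_eq0 -E; apply/eqP; ring.
Qed.

Hypothesis a0 : 0 < a.

Let b0 : 0 < b. Proof. exact: lt_trans ab. Qed.
Let xneq0 x : a <= x <= b -> x != 0.
Proof. by move=> /andP[ax _]; rewrite gt_eqF// (lt_le_trans a0). Qed.

(** The involution [x |-> a b / x] of [[a, b]] exchanges the two integrals up to
    the factor [sqrt (a b)]. *)
Lemma semicircle_int_inversion :
  J (fun x => x^-1) = Num.sqrt (a * b) * J (fun x => x^-1 ^+ 2).
Proof.
have ab0 : 0 < a * b by rewrite mulr_gt0.
pose F x : R := a * b * x^-1; pose dF x : R := - (a * b * x^-1 ^+ 2).
have Fa : F a = b by rewrite /F mulrAC divff ?mul1r// gt_eqF.
have Fb : F b = a by rewrite /F mulfK// gt_eqF.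
have decF : {in `[a, b]%R &, {homo F : x y /~ x < y}}.
  move=> x y; rewrite !in_itv/= => /andP[ax _] /andP[ay _] xy.
  by rewrite /F ltr_pM2l// ltf_pV2 ?posrE// (lt_le_trans a0).
have derF x : a <= x <= b -> is_derive x 1 F (dF x).
  move=> /xneq0 x0; rewrite /F /dF.
  have dV : is_derive x 1 (fun x : R => x^-1) (- (x ^- 2) *: 1).
    by apply: is_deriveV.
  by apply: is_derive_eq; rewrite /GRing.scale/= mulr1 exprVn; ring.
have cdF x : a <= x <= b -> {for x, continuous dF}.
  move=> /xneq0 x0; apply: cvgN; apply: cvgM; first exact: cvg_cst.
  apply: (@continuous_comp _ _ _ (fun x : R => x^-1) (fun x => x ^+ 2)).
    by apply: cvgV => //; exact: cvg_id.
  exact: exprn_continuous.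
have cV := @contV R a b a0.
have cG : {within `[F b, F a], continuous (fun x => x^-1 * semicircle a b x)}.
  by rewrite Fa Fb; exact: contw.
have := Rintegral_substitution_decreasing ab decF derF cdF cG.
rewrite Fa Fb {1}/semicircle_int => ->.
rewrite -semicircle_intZ; last first.
  exact: (contM cV cV).
congr (_ * _); apply: eq_Rintegral => x; rewrite inE/= in_itv/= => xab.
have x0 := xneq0 xab.
have x0' : 0 < x by case/andP: xab => ax _; rewrite (lt_le_trans a0).
rewrite /semicircle /F /dF [X in _ * Num.sqrt X * - _](_ : _ = a * b * ((x - a) * (b - x)) * (x^-1) ^+ 2).
  rewrite sqrtrM; last first.
    by case/andP: xab => ax xb; rewrite !mulr_ge0 ?subr_ge0// ltW.
  rewrite sqrtr_sqr ger0_norm ?invr_ge0 ?ltW// sqrtrM ?ltW//.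
  by field; rewrite x0 !gt_eqF.
by field.
Qed.

(** Integration by parts with [x^-1] gives a second relation between the integrals
    of [x^-1] and [x^-2], in addition to the inversion. *)
Lemma semicircle_intV : 2 * J (fun x => x^-1) = m - Num.sqrt (a * b).
Proof.
have ab0 : 0 < a * b by rewrite mulr_gt0.
set s := Num.sqrt (a * b); have s0 : 0 < s by rewrite sqrtr_gt0.
have sE : a * b = s ^+ 2 by rewrite sqr_sqrtr// ltW.
have cV := @contV R a b a0.
have cV2 : {within `[a, b], continuous (fun x => x^-1 ^+ 2)}.
  exact: (contM cV cV).
have cM (f : R -> R) (c : R) : {within `[a, b], continuous f} ->
    {within `[a, b], continuous (fun x => c * f x)}.
  by move=> cf; apply: contM => //; exact: cont_cst.
have c1 := @cont_cst R a b 1.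
have d x : a < x < b -> is_derive x 1 (fun x : R => x^-1) (-1 * x^-1 ^+ 2).
  move=> /andP[ax xb]; have x0 : x != 0 by apply: xneq0; rewrite !ltW.
  have dV : is_derive x 1 (fun x : R => x^-1) (- (x ^- 2) *: 1).
    by apply: is_deriveV.
  by apply: is_derive_eq; rewrite /GRing.scale/= mulr1 exprVn mulN1r.
have := semicircle_int_parts ab cV (cM _ (-1) cV2) d.
rewrite (@eq_semicircle_int R a b _ (fun x => (- 2) * 1 +
    (m * x^-1 + (a * b) * x^-1 ^+ 2))); last first.
  by move=> x /xneq0 x0; field.
rewrite (semicircle_intD (cM _ _ c1) (contD (cM _ _ cV) (cM _ _ cV2))).
rewrite (semicircle_intD (cM _ _ cV) (cM _ _ cV2)) !semicircle_intZ//.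
have := semicircle_int_inversion; rewrite -/s semicircle_int1 sE => -> E.
set j2 := J (fun x => x^-1 ^+ 2) in E *.
have ms : m + s != 0 by rewrite gt_eqF// addr_gt0// divr_gt0// addr_gt0.
apply: (mulfI ms); transitivity (2 * (m * (s * j2) + s ^+ 2 * j2)); first by ring.
move: E => /eqP; rewrite addrC addr_eq0 => /eqP ->.
transitivity (m ^+ 2 - s ^+ 2); last by ring.
by rewrite -sE; field.
Qed.

End SemicircleMoments.

(** * Measures with a density *)

Section Density.
Context {d} {T : measurableType d} {R : realType}.
Local Open Scope classical_set_scope.
Local Open Scope ereal_scope.
Context (P mu : {measure set T -> \bar R}) (D : set T) (p : T -> R).
Hypothesis mD : measurable D.
Hypothesis mp : measurable_fun D p.
Hypothesis p0 : forall x, D x -> (0 <= p x)%R.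
Hypothesis PE : forall S, measurable S -> S `<=` D ->
  P S = \int[mu]_(x in S) (p x)%:E.

Import HBNNSimple.

(** True for indicators by hypothesis, hence for simple functions, hence for all
    nonnegative measurable functions by monotone convergence. *)
Lemma ge0_integral_density (f : T -> \bar R) : (forall x, D x -> 0 <= f x) ->
  measurable_fun D f ->
  \int[P]_(x in D) f x = \int[mu]_(x in D) (f x * (p x)%:E).
Proof.
move=> f0 mf; pose h := nnsfun_approx mD mf.
have mhn n : measurable_fun D (EFin \o h n).
  by apply/measurable_EFinP; apply: (measurable_funS measurableT) => //.
have hmono a b x : (a <= b)%N -> (h a x <= h b x)%R.
  by move=> ab; have /lefP := nd_nnsfun_approx mD mf ab; exact.
have mpE : measurable_fun D (EFin \o p) by exact/measurable_EFinP.
have -> : \int[P]_(x in D) f x =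
    lim (\int[P]_(x in D) (EFin \o h n) x @[n --> \oo]).
  have fE x : D x -> f x = lim ((EFin \o h n) x @[n --> \oo]).
    by move=> Dx; apply/esym/cvg_lim => //; exact: cvg_nnsfun_approx.
  under eq_integral => x /[!inE] /fE -> //.
  apply: monotone_convergence => //.
  - by move=> n x Dx //=; rewrite lee_fin.
  - by move=> x Dx a b ab; rewrite lee_fin; exact: hmono.
have -> : \int[mu]_(x in D) (f x * (p x)%:E) =
    lim (\int[mu]_(x in D) ((EFin \o h n) x * (p x)%:E) @[n --> \oo]).
  have fg x : D x -> f x * (p x)%:E = lim ((EFin \o h n) x * (p x)%:E @[n --> \oo]).
    by move=> Dx; apply/esym/cvg_lim => //; apply: cvgeZr => //;
      exact: cvg_nnsfun_approx.
  under eq_integral => x /[!inE] /fg -> //.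
  apply: monotone_convergence => //.
  - by move=> n; exact: (emeasurable_funM (mhn n) mpE).
  - by move=> n x Dx /=; rewrite mule_ge0 ?lee_fin ?p0.
  - move=> x Dx a b ab/=; rewrite lee_wpmul2r ?lee_fin ?p0//.
    exact: hmono.
suff suf n : \int[P]_(x in D) (EFin \o h n) x =
    \int[mu]_(x in D) ((EFin \o h n) x * (p x)%:E).
  by under eq_fun do rewrite suf.
transitivity (\int[P]_(x in D)
   (\sum_(y \in range (h n)) (y * \1_(h n @^-1` [set y]) x)%:E)).
  by apply: eq_integral => t tE; rewrite /= fimfunE -fsumEFin.
have indich r : measurable_fun D (fun x => (r * \1_(h n @^-1` [set r]) x)%:E).
  by apply: (measurable_comp measurableT) => //; exact: measurable_funM.
rewrite ge0_integral_fsum//; last by move=> y x Dx; exact: nnfun_muleindic_ge0.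
transitivity (\int[mu]_(x in D) (\sum_(y \in range (h n))
    (y * \1_(h n @^-1` [set y]) x)%:E * (p x)%:E)); last first.
  apply: eq_integral => x xD.
  rewrite -ge0_mule_fsuml => [|y]; last exact: nnfun_muleindic_ge0.
  by rewrite /= fimfunE -fsumEFin.
rewrite ge0_integral_fsum//; last 2 first.
  - by move=> y; exact: (emeasurable_funM (indich y) mpE).
  - move=> y x Dx; apply: mule_ge0; last by rewrite lee_fin p0.
    exact: nnfun_muleindic_ge0.
apply: eq_fsbigr => r rhn.
rewrite integralZl_indic_nnsfun//.
under [RHS]eq_integral do rewrite EFinM -muleA.
rewrite ge0_integralZl//.
- under [in RHS]eq_integral do rewrite muleC.
  rewrite [in RHS](eq_integral ((EFin \o p) \_ (h n @^-1` [set r]))); last first.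
    by move=> x xD; rewrite epatch_indic.
  rewrite -integral_mkcondr integral_indic// setIC PE//.
- by apply: emeasurable_funM => //; exact/measurable_EFinP.
- by move=> t Dt; rewrite mule_ge0 ?lee_fin ?p0.
- by move: rhn; rewrite inE => -[t _ <-]; rewrite lee_fin.
Qed.

Lemma integral_null_setC (E : set T) (f : T -> \bar R) : measurable E ->
  measurable_fun setT f -> P (~` E) = 0 ->
  \int[P]_x f x = \int[P]_(x in E) f x.
Proof.
move=> mE mf PE0.
have nE g : measurable_fun setT g -> (forall x, 0 <= g x) ->
    \int[P]_x g x = \int[P]_(x in E) g x.
  move=> mg g0; rewrite (@ge0_negligible_integral _ _ _ P _ (~` E))//.
    by rewrite setTD setCK.
  exact: measurableC.
rewrite integralE [RHS]integralE !nE//.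
- exact: measurable_funeneg.
- exact: measurable_funepos.
Qed.

(** [E] may exceed [D] by a set on which the measure has no density, as long as
    [f] vanishes there: this is how the atom of the free Poisson law at [0] is
    dealt with. *)
Lemma Rintegral_density (E : set T) (f : T -> R) : measurable E ->
  measurable_fun setT f -> D `<=` E -> P (~` E) = 0 ->
  (forall x, D x -> (0 <= f x)%R) -> (forall x, E x -> ~ D x -> f x = 0%R) ->
  (\int[P]_x f x = \int[mu]_(x in D) (f x * p x))%R.
Proof.
move=> mE mf DE PE0 f0 fE; congr fine.
have mfE : measurable_fun setT (EFin \o f) by exact/measurable_EFinP.
rewrite (integral_null_setC mE mfE PE0) integral_mkcond.
rewrite (_ : _ \_ E = (EFin \o f) \_ D); last first.
  apply/funext => x; rewrite !patchE; case: ifPn => [/set_mem Ex|xE].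
    by case: ifPn => // xD; rewrite /= fE//; rewrite notin_setE in xD.
  by case: ifPn => // /set_mem /DE /mem_set; rewrite (negbTE xE).
rewrite -integral_mkcond ge0_integral_density//; exact: measurable_funTS.
Qed.

End Density.

Section DensityProbability.
Context {R : realType} (p : R -> R).
Local Open Scope classical_set_scope.
Local Open Scope ereal_scope.
Notation mu := (@lebesgue_measure R).

(** The hypotheses on [p] are arguments so that the measure can carry its
    probability structure. *)
Definition density_measure (p0 : forall x, (0 <= p x)%R)
    (mp : measurable_fun setT p) (p1 : \int[mu]_x (p x)%:E = 1)
    (S : set (measurableTypeR R)) : \bar R := \int[mu]_(x in S) (p x)%:E.

Context (p0 : forall x, (0 <= p x)%R) (mp : measurable_fun setT p)
  (p1 : \int[mu]_x (p x)%:E = 1).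
Local Notation P := (density_measure p0 mp p1).

Let P0 : P set0 = 0. Proof. by rewrite /density_measure integral_set0. Qed.

Let P_ge0 S : 0 <= P S.
Proof. by apply: integral_ge0 => x _; rewrite lee_fin. Qed.

Let P_sigma_additive : semi_sigma_additive P.
Proof.
move=> /= F mF tF mUF; rewrite /density_measure; apply: cvg_toP.
  apply: ereal_nondecreasing_is_cvgn => m n mn.
  apply: lee_sum_nneg_natr => // k _ _; apply: integral_ge0 => /= x Fkx.
  by rewrite lee_fin.
rewrite ge0_integral_bigcup//=.
- by apply/measurable_funTS/measurableT_comp.
- by move=> x _; rewrite lee_fin.
Qed.

HB.instance Definition _ := isMeasure.Build _ _ _ P P0 P_ge0 P_sigma_additive.
HB.instance Definition _ := @Measure_isProbability.Build _ _ R P p1.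

End DensityProbability.

Lemma density_probability {R : realType} (p : R -> R) :
  (forall x, 0 <= p x) -> measurable_fun setT p ->
  (\int[@lebesgue_measure R]_x (p x)%:E = 1)%E ->
  exists P : probability (measurableTypeR R) R,
    forall S, P S = (\int[@lebesgue_measure R]_(x in S) (p x)%:E)%E.
Proof. by move=> p0 mp p1; exists (density_measure p0 mp p1). Qed.

(** * Moments of the free GIG and free Poisson laws *)

Section GigMoments.
Context {R : realType} (lambda alpha beta a b : R).
Hypotheses (alpha0 : 0 < alpha) (beta0 : 0 < beta).
Hypothesis ends : free_gig_ends lambda alpha beta a b.
Local Open Scope classical_set_scope.
Notation mu := (@lebesgue_measure R).
Notation s := (Num.sqrt (a * b)).
Notation m := ((a + b) / 2).

Let a0 : 0 < a. Proof. by case: ends. Qed.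
Let ab : a < b. Proof. by case: ends. Qed.
Let b0 : 0 < b. Proof. exact: lt_trans ab. Qed.
Let s0 : 0 < s. Proof. by rewrite sqrtr_gt0 mulr_gt0. Qed.
Let sE : s ^+ 2 = a * b. Proof. by rewrite sqr_sqrtr// ltW// mulr_gt0. Qed.
Let xneq0 x : a <= x <= b -> x != 0.
Proof. by move=> /andP[ax _]; rewrite gt_eqF// (lt_le_trans a0). Qed.

Definition gig_weight (x : R) : R := alpha * x^-1 + beta / s * x^-1 ^+ 2.

Lemma gig_pdfE x : a <= x <= b -> free_gig_pdf alpha beta a b x =
  (2 * pi)^-1 * (gig_weight x * semicircle a b x).
Proof.
move=> /xneq0 x0; rewrite /free_gig_pdf /gig_weight -/(semicircle a b x) -mulrA.
congr (_ * _); rewrite mulrC; congr (_ * _); field.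
by rewrite x0 gt_eqF.
Qed.

Let cV : {within `[a, b], continuous (fun x : R => x^-1)}.
Proof. exact: contV. Qed.
Let cV2 : {within `[a, b], continuous (fun x : R => x^-1 ^+ 2)}.
Proof. exact: (contM cV cV). Qed.
Let cM (f : R -> R) (c : R) : {within `[a, b], continuous f} ->
  {within `[a, b], continuous (fun x => c * f x)}.
Proof. by move=> cf; apply: contM => //; exact: cont_cst. Qed.
Let c_weight : {within `[a, b], continuous gig_weight}.
Proof. by apply: contD; exact: cM. Qed.

Definition gig_moment n : R :=
  semicircle_int a b (fun x => x ^+ n * gig_weight x).

Lemma gig_moment0 : gig_moment 0 =
  alpha * semicircle_int a b (fun x => x^-1)
  + beta / s * semicircle_int a b (fun x => x^-1 ^+ 2).
Proof.
rewrite -!semicircle_intZ// -semicircle_intD; [|exact: cM..].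
by apply: eq_semicircle_int => x _; rewrite expr0 mul1r.
Qed.

Lemma gig_moment1 : gig_moment 1 =
  alpha * semicircle_int a b (fun x => x ^+ 0)
  + beta / s * semicircle_int a b (fun x => x^-1).
Proof.
have c0 := @contX R a b 0.
rewrite -!semicircle_intZ// -semicircle_intD; [|exact: cM..].
apply: eq_semicircle_int => x /xneq0 x0; rewrite /gig_weight; field.
by rewrite x0 gt_eqF.
Qed.

Lemma gig_momentSS n : gig_moment n.+2 =
  alpha * semicircle_int a b (fun x => x ^+ n.+1)
  + beta / s * semicircle_int a b (fun x => x ^+ n).
Proof.
have c0 := @contX R a b n; have c1 := @contX R a b n.+1.
rewrite -!semicircle_intZ// -semicircle_intD; [|exact: cM..].
apply: eq_semicircle_int => x /xneq0 x0; rewrite /gig_weight !exprS; field.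
by rewrite x0 gt_eqF.
Qed.

Let e1 : 1 - lambda + alpha * s - beta * (m / s ^+ 2) = 0.
Proof.
case: ends => _ _ <- _; congr (_ - _ * _); rewrite sE; field.
by rewrite !gt_eqF.
Qed.
Let e2 : 1 + lambda + beta / s - alpha * m = 0.
Proof. by case: ends. Qed.

(** The sum of the two equations for the endpoints reads
    [(alpha s + beta / s) (m / s - 1) = 2]. *)
Lemma gig_mass : gig_moment 0 = 1.
Proof.
rewrite gig_moment0; apply: (@mulfI _ (2 * s)); first by rewrite mulf_neq0// gt_eqF.
have jV := semicircle_intV ab a0; have jI := semicircle_int_inversion ab a0.
set j1 := semicircle_int _ _ _ in jV jI *; set j2 := semicircle_int _ _ _ in jI *.
transitivity (alpha * s * (2 * j1) + beta / s * (2 * (s * j2))); first by ring.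
rewrite -jI jV mulr1.
transitivity (2 * s + s * (1 - lambda + alpha * s - beta * (m / s ^+ 2)) * (-1)
  - s * (1 + lambda + beta / s - alpha * m)).
  by field; rewrite gt_eqF.
by rewrite e1 e2 !mulr0 mul0r subr0 addr0.
Qed.

Lemma gig_series_equation :
  gig_equation lambda alpha beta (gig_delta lambda alpha beta s m) fpsX gig_moment.
Proof.
have jV := semicircle_intV ab a0; have jI := semicircle_int_inversion ab a0.
have sm := semicircle_int_recursion ab; rewrite -sE in sm.
apply: (gig_moment_equation _ e1 e2 sm jV (esym jI) gig_moment0 gig_moment1
  gig_momentSS).
by rewrite gt_eqF.
Qed.

Let cpdf : {within `[a, b], continuous (free_gig_pdf alpha beta a b)}.
Proof.
apply: (@subspace_eq_continuous _ _ _
  (fun x => (2 * pi)^-1 * (gig_weight x * semicircle a b x))).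
  by move=> x; rewrite inE/= in_itv/= => /gig_pdfE.
by apply: cM; exact: contw.
Qed.

Let mpdf : measurable_fun `[a, b] (free_gig_pdf alpha beta a b).
Proof. exact: subspace_continuous_measurable_fun. Qed.

Let pdf0 x : `[a, b] x -> 0 <= free_gig_pdf alpha beta a b x.
Proof.
rewrite /= in_itv/= => /andP[ax xb]; have x0 : 0 < x by exact: lt_le_trans ax.
rewrite /free_gig_pdf !mulr_ge0 ?sqrtr_ge0 ?invr_ge0 ?mulr_ge0 ?pi_ge0//.
by rewrite addr_ge0// divr_ge0 ?mulr_ge0 ?exprn_ge0 ?ltW.
Qed.

Lemma Rintegral_gig_pdf n :
  (\int[mu]_(x in `[a, b]) (x ^+ n * free_gig_pdf alpha beta a b x)) = gig_moment n.
Proof.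
have cn := @contX R a b n.
rewrite /gig_moment /semicircle_int -RintegralZl//; last first.
  by apply: cont_integrable; apply: contw; exact: contM.
apply: eq_Rintegral => x; rewrite inE/= in_itv/= => /gig_pdfE ->.
by rewrite !mulrA; congr (_ * _ * _); rewrite mulrC.
Qed.

Lemma gig_moments (P : probability (measurableTypeR R) R) n :
  (forall S : set R, measurable S ->
    P S = (\int[mu]_(x in S `&` `[a, b]) (free_gig_pdf alpha beta a b x)%:E)%E) ->
  (\int[P]_x x ^+ n) = gig_moment n.
Proof.
move=> PE; rewrite -Rintegral_gig_pdf.
apply: (@Rintegral_density _ (measurableTypeR R) _ _ mu `[a, b] _ _ _ _ _ `[a, b]) => //.
- by move=> S mS Sab; rewrite -[in RHS](setIidl Sab); exact: PE.
- apply: etrans (PE _ (measurableC (measurable_itv _))) _.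
  by rewrite setICl integral_set0.
- by move=> x; rewrite /= in_itv/= => /andP[ax _]; rewrite exprn_ge0// ltW// (lt_le_trans a0).
Qed.

Lemma gig_probability : exists P : probability (measurableTypeR R) R,
  (forall S : set R, measurable S ->
    P S = (\int[mu]_(x in S `&` `[a, b]) (free_gig_pdf alpha beta a b x)%:E)%E).
Proof.
pose p := (free_gig_pdf alpha beta a b) \_ `[a, b].
have [||| P PE] := @density_probability R p.
- by move=> x; apply: restrict_ge0 => y; exact: pdf0.
- exact/(measurable_restrictT _ _).1.
- rewrite -gig_mass -Rintegral_gig_pdf.
  rewrite /Rintegral fineK; last first.
    apply: integrable_fin_num => //; apply: cont_integrable; apply: contM => //.
    exact: contX.
  rewrite [RHS]integral_mkcond; apply: eq_integral => x _.
  by rewrite /p !patchE; case: ifP => // _; rewrite expr0 mul1r.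
exists P => S mS; rewrite PE integral_mkcondr.
by apply: eq_integral => x _; rewrite /p !patchE; case: ifP.
Qed.

End GigMoments.

(** The map [t |-> beta / (alpha t)] exchanges [alpha s] and [beta / s], where
    [s = sqrt (a b)], and so exchanges the two equations for the endpoints up to
    the sign of [lambda]. The quantity [gig_delta] depends on [lambda] only
    through [(1 - lambda) ^+ 2], apart from terms that this exchange preserves. *)
Lemma free_gig_ends_reflect {R : realType} (lambda alpha beta a b : R) :
  0 < alpha -> 0 < beta -> free_gig_ends (- lambda) alpha beta a b ->
  free_gig_ends lambda alpha beta (beta / (alpha * b)) (beta / (alpha * a)) /\
  gig_delta lambda alpha beta
    (Num.sqrt (beta / (alpha * b) * (beta / (alpha * a))))
    ((beta / (alpha * b) + beta / (alpha * a)) / 2)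
  = gig_delta (- lambda) alpha beta (Num.sqrt (a * b)) ((a + b) / 2) - lambda.
Proof.
move=> al0 be0 [a0 ab e1 e2]; have b0 : 0 < b by exact: lt_trans ab.
set s := Num.sqrt (a * b) in e1 e2 *.
have s0 : 0 < s by rewrite sqrtr_gt0 mulr_gt0.
have sE : a * b = s ^+ 2 by rewrite sqr_sqrtr// ltW// mulr_gt0.
have sqE :
    Num.sqrt (beta / (alpha * b) * (beta / (alpha * a))) = beta / (alpha * s).
  rewrite (_ : _ * _ = (beta / (alpha * s)) ^+ 2).
    by rewrite sqrtr_sqr ger0_norm// divr_ge0 ?mulr_ge0 ?ltW.
  rewrite exprMn exprVn exprMn -sE; field.
  by rewrite !gt_eqF.
split.
  split.
  - by rewrite divr_gt0 ?mulr_gt0.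
  - by rewrite ltr_pM2l// ltf_pV2 ?posrE ?mulr_gt0// ltr_pM2l.
  - rewrite sqE -[RHS]e2; field.
    by rewrite !gt_eqF.
  - by rewrite sqE -[RHS]e1; field; rewrite !gt_eqF.
rewrite /gig_delta sqE.
rewrite (_ : (beta / (alpha * b) + beta / (alpha * a)) / 2 =
  beta * ((a + b) / 2) / (alpha * s ^+ 2)); last first.
  by rewrite -sE; field; rewrite !gt_eqF.
by field; rewrite !gt_eqF.
Qed.

Section PoissonMoments.
Context {R : realType} (lambda alpha : R).
Hypotheses (alpha0 : 0 < alpha) (lambda0 : 0 < lambda).
Local Open Scope classical_set_scope.
Notation mu := (@lebesgue_measure R).
Notation gamma := (1 / alpha).

Definition poisson_left : R := gamma * (1 - Num.sqrt lambda) ^+ 2.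
Definition poisson_right : R := gamma * (1 + Num.sqrt lambda) ^+ 2.
Notation a := poisson_left.
Notation b := poisson_right.

Let g0 : 0 < gamma. Proof. exact: divr_gt0. Qed.
Let r0 : 0 < Num.sqrt lambda. Proof. by rewrite sqrtr_gt0. Qed.
Let rE : Num.sqrt lambda ^+ 2 = lambda. Proof. by rewrite sqr_sqrtr// ltW. Qed.
Let a0 : 0 <= a. Proof. by apply: mulr_ge0; [exact: ltW|exact: sqr_ge0]. Qed.
Let ab : a < b.
Proof.
rewrite /a /b -subr_gt0 (_ : _ - _ = gamma * (4 * Num.sqrt lambda)); last by ring.
by apply: mulr_gt0 => //; exact: mulr_gt0.
Qed.

Let x0 x : x \in `]a, b[%R -> 0 < x.
Proof. by rewrite in_itv/= => /andP[ax _]; exact: le_lt_trans ax. Qed.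

Lemma poisson_pdfE x : x \in `]a, b[%R ->
  free_poisson_pdf lambda gamma x = (2 * pi)^-1 * (alpha * x^-1 * semicircle a b x).
Proof.
move=> /x0 xp; rewrite /free_poisson_pdf /semicircle.
rewrite (_ : 4 * lambda * _ - _ = (x - a) * (b - x)).
  have pi0 : (pi : R) != 0 by rewrite gt_eqF// pi_gt0.
  move: pi0; generalize (pi : R) => p p0.
  by field; rewrite p0 !gt_eqF.
by rewrite /a /b; move: rE; set r := Num.sqrt lambda => <-; field; rewrite gt_eqF.
Qed.

Definition poisson_moment n : R :=
  if n is k.+1 then alpha * semicircle_int a b (fun x => x ^+ k) else 1.

Lemma poisson_series_equation :
  gig_equation lambda alpha 0 0 fpsX poisson_moment.
Proof.
apply: (poisson_moment_equation _ _ (semicircle_int_recursion ab)) => //.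
- by rewrite /a /b; move: rE; set r := Num.sqrt lambda => <-; field; rewrite gt_eqF.
- by rewrite /a /b; move: rE; set r := Num.sqrt lambda => <-; field; rewrite gt_eqF.
Qed.

Lemma poisson_moments (P : probability (measurableTypeR R) R) n :
  free_poisson lambda gamma P -> (\int[P]_x x ^+ n) = poisson_moment n.
Proof.
case: n => [PE|n PE] /=.
  under eq_Rintegral do rewrite expr0.
  by rewrite Rintegral_cst// mul1r; exact: (congr1 fine (probability_setT P)).
pose D : set R := `]a, b[; pose E : set R := D `|` [set 0].
have mD : measurable D by exact: measurable_itv.
have mE : measurable E by exact: measurableU.
have D0 x : D x -> 0 < x by exact: x0.
have mpdf : measurable_fun D (free_poisson_pdf lambda gamma).
  suff : measurable_fun D
      (fun x => (2 * pi)^-1 * (alpha * x^-1 * semicircle a b x)).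
    by apply: eq_measurable_fun => x; rewrite inE => /poisson_pdfE.
  apply: open_continuous_measurable_fun; first exact: interval_open.
  move=> x; rewrite inE => /D0 xp; apply: cvgM; first exact: cvg_cst.
  apply: cvgM; last exact: semicircle_continuous.
  apply: cvgM; first exact: cvg_cst.
  by apply: cvgV; [rewrite gt_eqF|exact: cvg_id].
have pdf0 x : D x -> 0 <= free_poisson_pdf lambda gamma x.
  move=> Dx; rewrite poisson_pdfE//; have xp := D0 x Dx.
  rewrite mulr_ge0 ?invr_ge0 ?mulr_ge0 ?pi_ge0 ?invr_ge0 ?sqrtr_ge0 ?ltW//.
have dirac0 (S : set R) : ~ S 0 -> \d_(0 : R) S = 0%E :> \bar R.
  by move=> S0; rewrite diracE memNset.
have PD (S : set R) : measurable S -> S `<=` D ->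
    P S = (\int[mu]_(x in S) (free_poisson_pdf lambda gamma x)%:E)%E.
  move=> mS SD; apply: etrans (PE S mS) _.
  rewrite dirac0; last by move=> /SD /D0; rewrite ltxx.
  by rewrite mule0 add0e setIidl.
have PE0 : P (~` E) = 0%E.
  apply: etrans (PE _ (measurableC mE)) _.
  rewrite dirac0; last by apply; right.
  rewrite mule0 add0e (_ : _ `&` _ = set0) ?integral_set0//.
  by apply/seteqP; split=> // x [Ex Dx]; apply: Ex; left.
rewrite (@Rintegral_density _ (measurableTypeR R) R P mu D _ mD mpdf pdf0 PD E)//.
- pose h x : R := (2 * pi)^-1 * (alpha * (x ^+ n * semicircle a b x)).
  have hc : continuous h.
    move=> x; apply: cvgM; first exact: cvg_cst.
    apply: cvgM; first exact: cvg_cst.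
    by apply: cvgM; [exact: exprn_continuous|exact: semicircle_continuous].
  transitivity (\int[mu]_(x in D) h x).
    apply: eq_Rintegral => x; rewrite inE => Dx.
    rewrite poisson_pdfE// /h exprS.
    have pi0 : (pi : R) != 0 by rewrite gt_eqF// pi_gt0.
    move: pi0; generalize (pi : R) => p p0; field.
    by rewrite p0 gt_eqF// D0.
  have ch : {within `[a, b], continuous h}.
    by apply: cont_continuous => x; exact: hc.
  have ih := cont_integrable ch.
  rewrite /D Rintegral_itv_obnd_cbnd; last first.
    by apply: integrableS ih => //; exact: subset_itv_oo_cc.
  rewrite Rintegral_itv_bndo_bndc; last first.
    by apply: integrableS ih => //; exact: subset_itv_co_cc.
  rewrite -semicircle_intZ//; last exact: contX.
  rewrite /semicircle_int -RintegralZl//; last first.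
    apply: cont_integrable; apply: contw; apply: contM; first exact: cont_cst.
    exact: contX.
  by apply: eq_Rintegral => x _; rewrite /h !mulrA.
- by move=> x Dx; left.
- by move=> x /D0 xp; rewrite exprn_ge0// ltW.
- by move=> x [//|->] _; rewrite expr0n.
Qed.

End PoissonMoments.

(** * Adding a free Poisson variable *)

Theorem mainTheorem2 (R : realType) (P : starProbSpace R)
    (alpha beta lambda : R) (X Y : P)
    (mu nu : probability (measurableTypeR R) R) :
  0 < alpha -> 0 < beta -> 0 < lambda ->
  selfadjoint X -> selfadjoint Y ->
  free_rvs X Y ->
  distribution_of X mu -> free_gig (- lambda) alpha beta mu ->
  distribution_of Y nu -> free_poisson lambda (1 / alpha) nu ->
  exists2 rho : probability (measurableTypeR R) R,
    distribution_of (X + Y) rho & free_gig lambda alpha beta rho.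
Proof.
move=> al0 be0 la0 _ _ freeXY [_ momX] [a [b [ends muE]]] [_ momY] nuE.
have [ends' deltaE] := free_gig_ends_reflect al0 be0 ends.
have [rho rhoE] := gig_probability al0 be0 ends'.
exists rho; last by do 2 eexists; split; [exact: ends'|exact: rhoE].
have eqX := gig_series_equation ends.
have eqY := poisson_series_equation al0 la0.
have eqS := gig_series_equation ends'; rewrite deltaE in eqS.
pose C := real_complex R.
have {}eqX := gig_equation_map C eqX; have {}eqY := gig_equation_map C eqY.
have {}eqS := gig_equation_map C eqS.
rewrite !fps_map_fpsX rmorphN in eqX; rewrite !fps_map_fpsX rmorph0 in eqY.
rewrite !fps_map_fpsX rmorphB in eqS.
have al0' : C alpha != 0 by rewrite fmorph_eq0 gt_eqF.
have M0 : fps_map C (gig_moment alpha beta (beta / (alpha * b))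
    (beta / (alpha * a))) 0%N = 1.
  by rewrite /fps_map (gig_mass ends') rmorph1.
have [kX [kY [vX [vY [[kX0 kY0 vX0 vY0] [MX MY Mk vkX vkY]]]]]] :=
  gig_subordination al0' M0 eqX eqY eqS.
have seriesX : moment_series state X = fps_map C (gig_moment alpha beta a b).
  by apply/funext => n; rewrite /moment_series momX (gig_moments al0 be0 ends _ muE).
have seriesY : moment_series state Y = fps_map C (poisson_moment lambda alpha).
  by apply/funext => n; rewrite /moment_series momY (poisson_moments al0 la0 _ nuE).
rewrite -seriesX in MX; rewrite -seriesY in MY.
have MS := free_sum_moments (state1 P) freeXY kX0 kY0 vX0 vY0 MX MY Mk vkX vkY.
split.
  exists `[beta / (alpha * b), beta / (alpha * a)]%classic.
    exact: segment_compact.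
  apply: etrans (rhoE _ (measurableC (measurable_itv _))) _.
  by rewrite setICl integral_set0.
move=> n; rewrite (gig_moments al0 be0 ends' _ rhoE).
exact: (congr1 (@^~ n) MS).
Qed.
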